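(* Let $n$ be a positive integer, let $\Lambda$ be a basic minimal $n$-Auslander-Gorenstein algebra, and let $N$ be a $\Lambda$-module. Then the following are equivalent: (1) the Gorenstein projective dimension of $N$ is at most $n$; (2) the Gorenstein projective dimension of $\mathrm{soc}(N)$ is at most $n$; (3) $N$ is cogenerated by a finite direct sum of copies of $\Lambda$. That is, $\mathrm{GP}^{\le n}(\Lambda)=\{N\in\Lambda\text{-mod}\mid\mathrm{Gpd}(\mathrm{soc}\,N)\le n\}=\mathrm{sub}\,\Lambda$.
   Context: All modules are finitely generated left modules; $\Lambda\text{-mod}$ is the category of finitely generated left $\Lambda$-modules. For a minimal injective coresolution $0\to\Lambda\to I_0\to I_1\to\cdots$ of the left regular module, the dominant dimension $\mathrm{domdim}\,\Lambda$ is the supremum of the integers $d\ge 0$ such that $I_j$ is projective for all $0\le j<d$. An Artin algebra $\Lambda$ is a minimal $n$-Auslander-Gorenstein algebra if $\mathrm{id}\,{}_\Lambda\Lambda\le n+1\le\mathrm{domdim}\,\Lambda$, where $\mathrm{id}$ is injective dimension. $\mathrm{soc}$ denotes the socle. $\mathrm{Gpd}$ denotes the Gorenstein projective dimension: a module is Gorenstein projective if it is a syzygy (image of a differential) of an exact complex of finitely generated projective modules that stays exact after applying $\mathrm{Hom}_\Lambda(-,\Lambda)$, and $\mathrm{Gpd}\,N$ is the minimal length of a resolution of $N$ by Gorenstein projective modules ($\infty$ if no finite one exists); the zero module is regarded as having $\mathrm{Gpd}\le n$. $\mathrm{GP}^{\le n}(\Lambda)$ is the full subcategory of $\Lambda$-modules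 $N$ with $\mathrm{Gpd}\,N\le n$. ''Cogenerated by a finite direct sum of copies of $\Lambda$'' means isomorphic to a submodule of $\Lambda^k$ for some $k\ge 0$; $\mathrm{sub}\,\Lambda$ is the full subcategory of such modules. *)

(* Defs.v *)
From HB Require Import structures.
From mathcomp Require Import all_boot all_order all_algebra.
From mathcomp Require Import boolp.

Set Implicit Arguments.
Unset Strict Implicit.
Unset Printing Implicit Defensive.

Import GRing.Theory.

Local Open Scope ring_scope.

(* Submodules of M are the A : {pred M} with GRing.submod_closed A. Membership
   is boolean, which under the classical axioms of boolp loses no generality. *)

Section Modules.
Variable R : pzRingType.
Implicit Types M N : lmodType R.

Definition finitely_generated M : Prop :=
  exists (m : nat) (e : 'I_m -> M),
    forall x : M, exists c : 'I_m -> R, x = \sum_(i < m) c i *: e i.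

Definition zero_module M : Prop := forall x : M, x = 0.

Definition mono (M N : lmodType R) (f : {linear M -> N}) : Prop :=
  injective f.

Definition epi (M N : lmodType R) (f : {linear M -> N}) : Prop :=
  forall y : N, exists x : M, f x = y.

Definition exact_at (L M N : lmodType R)
    (f : {linear L -> M}) (g : {linear M -> N}) : Prop :=
  forall y : M, g y = 0 <-> exists x : L, f x = y.

Definition isomorphic M N : Prop := exists f : {linear M -> N}, bijective f.

(* Projective and injective objects of the category R-mod of finitely
   generated modules: the test objects A and B are finitely generated too. *)
Definition fg_projective (P : lmodType R) : Prop :=
  finitely_generated P /\
  forall (A B : lmodType R) (g : {linear A -> B}) (f : {linear P -> B}),
    finitely_generated A -> finitely_generated B -> epi g ->
    exists h : {linear P -> A}, forall x : P, g (h x) = f x.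

Definition fg_injective (I : lmodType R) : Prop :=
  finitely_generated I /\
  forall (A B : lmodType R) (g : {linear A -> B}) (f : {linear A -> I}),
    finitely_generated A -> finitely_generated B -> mono g ->
    exists h : {linear B -> I}, forall x : A, h (g x) = f x.

(* 0 -> M -> I 0 -> I 1 -> ... *)
Definition injective_coresolution M (I : nat -> lmodType R)
    (eta : {linear M -> I 0%N}) (d : forall i, {linear I i -> I i.+1}) : Prop :=
  [/\ forall i, fg_injective (I i),
      mono eta,
      exact_at eta (d 0%N)
    & forall i, exact_at (d i) (d i.+1)].

Definition essential_image (M N : lmodType R) (f : {linear M -> N}) : Prop :=
  forall A : {pred N}, GRing.submod_closed A ->
    (exists2 y : N, y \in A & y != 0) ->
    exists2 x : M, f x \in A & f x != 0.

(* Each I i is an injective envelope of the image of the map into it. *)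
Definition minimal_injective_coresolution M (I : nat -> lmodType R)
    (eta : {linear M -> I 0%N}) (d : forall i, {linear I i -> I i.+1}) : Prop :=
  [/\ injective_coresolution eta d,
      essential_image eta
    & forall i, essential_image (d i)].

Definition injdim_le (m : nat) M : Prop :=
  exists (I : nat -> lmodType R) (eta : {linear M -> I 0%N})
         (d : forall i, {linear I i -> I i.+1}),
    injective_coresolution eta d /\
    forall i, (m < i)%N -> zero_module (I i).

(* m <= domdim R. The integers d in the supremum defining domdim R form an
   initial segment of nat, so m is below the supremum iff m is one of them. *)
Definition domdim_ge (m : nat) : Prop :=
  exists (I : nat -> lmodType R) (eta : {linear R^o -> I 0%N})
         (d : forall i, {linear I i -> I i.+1}),
    minimal_injective_coresolution eta d /\
    forall j, (j < m)%N -> fg_projective (I j).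

Definition totally_acyclic (P : int -> lmodType R)
    (d : forall i, {linear P i -> P (i + 1)}) : Prop :=
  [/\ forall i, fg_projective (P i),
      forall i, exact_at (d i) (d (i + 1))
    & forall i (g : {linear P (i + 1) -> R^o}),
        (forall x, g (d i x) = 0) ->
        exists h : {linear P (i + 1 + 1) -> R^o},
          forall y, g y = h (d (i + 1) y)].

(* G is isomorphic to the image of a differential d i, through a factorisation
   of d i as a surjection onto G followed by an injection. *)
Definition gorenstein_projective (G : lmodType R) : Prop :=
  exists (P : int -> lmodType R) (d : forall i, {linear P i -> P (i + 1)}),
    totally_acyclic d /\
    exists (i : int) (p : {linear P i -> G}) (j : {linear G -> P (i + 1)}),
      [/\ epi p, mono j & forall x, d i x = j (p x)].

(* 0 -> G m -> ... -> G 0 -> M -> 0, continued by zero in degrees above m. *)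
Definition Gpd_le (m : nat) M : Prop :=
  exists (G : nat -> lmodType R) (e : {linear G 0%N -> M})
         (d : forall i, {linear G i.+1 -> G i}),
    [/\ forall i, gorenstein_projective (G i),
        epi e /\ exact_at (d 0%N) e,
        forall i, exact_at (d i.+1) (d i)
      & forall i, (m < i)%N -> zero_module (G i)].

(* M is isomorphic to a submodule of some R^k. *)
Definition cogenerated_by_regular M : Prop :=
  exists (k : nat) (f : {linear M -> 'rV[R]_k}), mono f.

Definition indecomposable M : Prop :=
  ~ zero_module M /\
  forall A B : {pred M},
    GRing.submod_closed A -> GRing.submod_closed B ->
    (forall x, exists2 a, a \in A & exists2 b, b \in B & x = a + b) ->
    (forall x, x \in A -> x \in B -> x = 0) ->
    (forall x, x \in A -> x = 0) \/ (forall x, x \in B -> x = 0).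

(* M is the internal direct sum of the images of the u i, each u i being
   automatically injective. *)
Definition direct_sum_of M (m : nat) (P : 'I_m -> lmodType R)
    (u : forall i, {linear P i -> M}) : Prop :=
  forall x : M, exists! y : (forall i, P i), x = \sum_(i < m) u i (y i).

(* The regular module is a direct sum of pairwise non-isomorphic
   indecomposable modules. *)
Definition basic_ring : Prop :=
  exists (m : nat) (P : 'I_m -> lmodType R)
         (u : forall i, {linear P i -> R^o}),
    [/\ direct_sum_of u,
        forall i, indecomposable (P i)
      & forall i j, i != j -> ~ isomorphic (P i) (P j)].

Definition simple_submodule M (A : {pred M}) : Prop :=
  [/\ GRing.submod_closed A,
      exists2 x, x \in A & x != 0
    & forall B : {pred M}, GRing.submod_closed B -> {subset B <= A} ->
        (forall x, x \in B -> x = 0) \/ {subset A <= B}].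

(* The sum of all simple submodules. *)
Definition socle M : {pred M} := fun x =>
  `[< exists s : seq M,
        (forall y, y \in s ->
           exists2 A : {pred M}, simple_submodule A & y \in A) /\
        x = \sum_(y <- s) y >].

Lemma socle_submod_closed M : GRing.submod_closed (@socle M).
Proof.
split=> [|a x y].
  by apply/asboolP; exists [::]; rewrite big_nil; split.
move=> /asboolP [s [sS ->]] /asboolP [t [tS ->]].
apply/asboolP; exists ([seq a *: z | z <- s] ++ t); split; last first.
  by rewrite big_cat /= big_map -scaler_sumr.
move=> z; rewrite mem_cat => /orP [/mapP [w ws ->]|/tS //].
have [A [Asub A0 Amin] wA] := sS w ws.
exists A => //; case: Asub => A00 Alin.
by rewrite -[_ *: _]addr0; apply: Alin.
Qed.

HB.instance Definition _ M :=
  GRing.isSubmodClosed.Build R M (@socle M) (@socle_submod_closed M).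

Record soc M := Soc { soc_val :> M; _ : soc_val \in @socle M }.

HB.instance Definition _ M := [isSub for @soc_val M].
HB.instance Definition _ M := [Choice of soc M by <:].
HB.instance Definition _ M := [SubChoice_isSubLmodule of soc M by <:].

End Modules.

(* The descending chain condition on ideals. *)
Definition artinian (k : comPzRingType) : Prop :=
  forall I : nat -> {pred k^o},
    (forall i, GRing.submod_closed (I i)) ->
    (forall i, {subset I i.+1 <= I i}) ->
    exists m : nat, forall i, (m <= i)%N -> I i =i I m.

Definition artin_algebra (k : comPzRingType) (L : algType k) : Prop :=
  artinian k /\ finitely_generated (L : lmodType k).

Definition minimal_Auslander_Gorenstein (n : nat) (k : comPzRingType)
    (L : algType k) : Prop :=
  [/\ artin_algebra L, injdim_le n.+1 (L^o : lmodType L) & domdim_ge L n.+1].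

(* Main.v *)
From HB Require Import structures.
Require Import Defs.
From mathcomp Require Import all_boot all_order all_algebra.
From mathcomp Require Import boolp classical_sets.

(* Write D_m for the modules with m projective-injective terms at the start of
   an injective coresolution.  Gorenstein projectives lie in D_(n+1), and each
   step down a resolution costs one index, so Gpd N <= n puts N in D_1, that is
   in sub L.  A module all of whose simple submodules embed in
   projective-injectives embeds in one itself, whence the statement on socles.

   Conversely let N be in sub L.  As id L <= n+1, the n-th syzygy G of N is
   torsionless with Ext^i(G, L) = 0 for all i > 0.  Such a G continues to the
   right along left approximations by free modules, provided that every C with
   Ext^i(C, L) = 0 for i > 0 is torsionless.  The coresolution of an
   indecomposable projective P reads 0 -> P -> I_0 -> ... -> I_n -> J -> 0 with
   the I_i projective-injective and J injective.  Counting simple modules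
   against indecomposable projectives shows that every simple module embeds in
   a projective-injective or in such a J; hence C embeds in a finite sum of
   them, and its maps to the J lift to the I_n. *)

Set Implicit Arguments.
Unset Strict Implicit.
Unset Printing Implicit Defensive.

Import GRing.Theory.

Local Open Scope ring_scope.

(** * Quotients, submodules and linear maps *)

(** Vanishing of Ext^(j+1)(M, P) is rendered as a lifting property of M against the j-th cosyzygies
    of P, which speaks only of maps and injective coresolutions. The finitely generated injectives
    that this calls for come out of the counting itself, which embeds each simple module in one. The
    ground ring k enters twice: it gives L finite length, so that minimal submodules and Fitting's
    lemma are at hand, and it makes Hom(M, L) finitely generated, which yields the approximations.
    Basicness enters the counting: the summands of L are pairwise non-isomorphic, so distinct
    indices stand for distinct classes and an injection on the indices is a bijection. The obstacle
    there is that one simple module might sit in the ends J of two different coresolutions. Maps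
    between the two ends descend to the projectives at the start, where an endomorphism is nilpotent
    or invertible, and are compared modulo maps that factor through projective-injectives. The bound
    n, instead of n + 1, is due to N being itself a syzygy, namely of L^t / N. *)

Section QuotientModule.
Variables (R : pzRingType) (M : lmodType R) (A : {pred M}).
Hypothesis A_closed : GRing.submod_closed A.

Let A0 : 0 \in A. Proof. by case: A_closed. Qed.
Let AD x y : x \in A -> y \in A -> x + y \in A.
Proof. by move=> xA yA; rewrite -[x]scale1r; case: A_closed => _; apply. Qed.
Let AZ a x : x \in A -> a *: x \in A.
Proof. by move=> xA; rewrite -[_ *: _]addr0; case: A_closed => _; apply. Qed.
Let AN x : x \in A -> - x \in A.
Proof. by rewrite -scaleN1r; apply: AZ. Qed.

Let repr_ex x : exists y, y - x \in A.
Proof. by exists x; rewrite subrr. Qed.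

(** [xchoose] depends only on the extension of its predicate, so the same element is chosen from
    every member of a coset. The quotient can then be carried by the chosen representatives. *)
Definition quot_repr (x : M) : M := xchoose (repr_ex x).

Lemma quot_reprP x : quot_repr x - x \in A.
Proof. exact: xchooseP (repr_ex x). Qed.

Lemma quot_repr_eq x y : (quot_repr x == quot_repr y) = (x - y \in A).
Proof.
apply/eqP/idP => [e|xyA].
  rewrite -(subrKA (quot_repr y)) -{1}e AD ?quot_reprP //.
  by rewrite -opprB AN ?quot_reprP.
apply: eq_xchoose => z; apply/idP/idP => zA.
  by rewrite -(subrKA x) AD.
by rewrite -(subrKA y) AD // -opprB AN.
Qed.

Definition quot_mod := {x : M | quot_repr x == x}.
HB.instance Definition _ := Choice.on quot_mod.

Let repr_idem x : quot_repr (quot_repr x) == quot_repr x.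
Proof. by rewrite quot_repr_eq quot_reprP. Qed.

Definition quot_pi (x : M) : quot_mod := exist _ (quot_repr x) (repr_idem x).

Lemma quot_piE x y : quot_pi x = quot_pi y <-> x - y \in A.
Proof.
rewrite -quot_repr_eq; split=> [/(congr1 val)/eqP //|/eqP e].
exact: val_inj.
Qed.

Lemma quot_valK (q : quot_mod) : quot_pi (val q) = q.
Proof. by apply: val_inj; case: q => x /= /eqP. Qed.

Let piP x : val (quot_pi x) - x \in A. Proof. exact: quot_reprP. Qed.

Definition quot_add (p q : quot_mod) := quot_pi (val p + val q).
Definition quot_opp (p : quot_mod) := quot_pi (- val p).
Definition quot_scale a (p : quot_mod) := quot_pi (a *: val p).

Lemma quot_piD x y : quot_add (quot_pi x) (quot_pi y) = quot_pi (x + y).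
Proof. by apply/quot_piE; rewrite opprD addrACA AD. Qed.
Lemma quot_piN x : quot_opp (quot_pi x) = quot_pi (- x).
Proof. by apply/quot_piE; rewrite -opprD AN. Qed.
Lemma quot_piZ a x : quot_scale a (quot_pi x) = quot_pi (a *: x).
Proof. by apply/quot_piE; rewrite -scalerBr AZ. Qed.

Let quot_ind (P : quot_mod -> Prop) : (forall x, P (quot_pi x)) ->
  forall q, P q.
Proof. by move=> Ppi q; rewrite -(quot_valK q). Qed.

Lemma quot_addA : associative quot_add.
Proof. by do 3!elim/quot_ind => ?; rewrite !quot_piD addrA. Qed.
Lemma quot_addC : commutative quot_add.
Proof. by do 2!elim/quot_ind => ?; rewrite !quot_piD addrC. Qed.
Lemma quot_add0 : left_id (quot_pi 0) quot_add.
Proof. by elim/quot_ind => ?; rewrite quot_piD add0r. Qed.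
Lemma quot_addN : left_inverse (quot_pi 0) quot_opp quot_add.
Proof. by elim/quot_ind => ?; rewrite quot_piN quot_piD addNr. Qed.

HB.instance Definition _ :=
  GRing.isZmodule.Build quot_mod quot_addA quot_addC quot_add0 quot_addN.

Lemma quot_scaleA a b v : quot_scale a (quot_scale b v) = quot_scale (a * b) v.
Proof. by elim/quot_ind: v => ?; rewrite !quot_piZ scalerA. Qed.
Lemma quot_scale1 : left_id 1 quot_scale.
Proof. by elim/quot_ind => ?; rewrite quot_piZ scale1r. Qed.
Lemma quot_scaleDr : right_distributive quot_scale +%R.
Proof.
move=> a; elim/quot_ind => x; elim/quot_ind => y.
rewrite -![_ + _]/(quot_add _ _) quot_piD !quot_piZ quot_piD.
by rewrite scalerDr.
Qed.
Lemma quot_scaleDl v : {morph quot_scale^~ v : a b / a + b}.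
Proof.
elim/quot_ind: v => x a b.
by rewrite -[RHS]/(quot_add _ _) !quot_piZ quot_piD scalerDl.
Qed.

HB.instance Definition _ := GRing.Zmodule_isLmodule.Build R quot_mod
  quot_scaleA quot_scale1 quot_scaleDr quot_scaleDl.

Lemma quot_pi_linear : linear quot_pi.
Proof. by move=> a x y; rewrite -quot_piD -quot_piZ. Qed.

HB.instance Definition _ :=
  GRing.isLinear.Build R M quot_mod *:%R quot_pi quot_pi_linear.

End QuotientModule.

Section Submodule.
Variables (R : pzRingType) (M : lmodType R) (A : {pred M}).
Hypothesis A_closed : GRing.submod_closed A.

(* A copy of [A] that depends on the closure proof, so that canonical
   structures can be attached to it. *)
Definition keyed_pred (_ : GRing.submod_closed A) : {pred M} := A.

HB.instance Definition _ :=
  GRing.isSubmodClosed.Build R M (keyed_pred A_closed) A_closed.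

Record sub_mod := SubMod { sub_val :> M; _ : sub_val \in keyed_pred A_closed }.

HB.instance Definition _ := [isSub for sub_val].
HB.instance Definition _ := [Choice of sub_mod by <:].
HB.instance Definition _ := [SubChoice_isSubLmodule of sub_mod by <:].

End Submodule.

Section LinearConstructions.
Variable R : pzRingType.
Implicit Types M N A B C X Y : lmodType R.

Lemma linear_of_fun M N (f : M -> N) : linear f ->
  exists g : {linear M -> N}, g =1 f.
Proof.
move=> fL.
pose F := HB.pack_for {linear M -> N} f (GRing.isLinear.Build R M N *:%R f fL).
by exists F.
Qed.

Lemma linear_of_rel M N (r : M -> N -> Prop) :
    (forall x, exists y, r x y) ->
    (forall x y z, r x y -> r x z -> y = z) ->
    (forall a x x' y y', r x y -> r x' y' -> r (a *: x + x') (a *: y + y')) ->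
  exists g : {linear M -> N}, forall x, r x (g x).
Proof.
move=> /choice[f fP] r_fun r_lin.
have [a x y|g gf] := @linear_of_fun M N f.
  by apply: r_fun (fP _) _; apply: r_lin.
by exists g => x; rewrite gf.
Qed.

Lemma quot_exists M (A : {pred M}) : GRing.submod_closed A ->
  exists (Q : lmodType R) (p : {linear M -> Q}),
    epi p /\ forall x, p x = 0 <-> x \in A.
Proof.
move=> A_closed; exists (quot_mod A_closed), (quot_pi A_closed); split=> [q|x].
  by exists (val q); apply: quot_valK.
by rewrite -(linear0 (quot_pi A_closed)) quot_piE subr0.
Qed.

Lemma sub_exists M (A : {pred M}) : GRing.submod_closed A ->
  exists (S : lmodType R) (i : {linear S -> M}),
    mono i /\ forall x, x \in A <-> exists s, i s = x.
Proof.
move=> A_closed; exists (sub_mod A_closed), (val : {linear _ -> _}).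
split=> [|x]; first exact: val_inj.
split=> [xA|[s <-]]; last exact: valP.
by exists (SubMod (xA : x \in keyed_pred A_closed)).
Qed.

End LinearConstructions.

(** * Short exact sequences, factorisations and finite generation *)

Section ShortExact.
Variable R : pzRingType.
Implicit Types M N A B C X Y : lmodType R.

Definition ses A B C (i : {linear A -> B}) (p : {linear B -> C}) : Prop :=
  [/\ mono i, epi p & exact_at i p].

Lemma ses_comp0 A B C (i : {linear A -> B}) (p : {linear B -> C}) :
  ses i p -> forall x, p (i x) = 0.
Proof. by case=> _ _ ex x; apply/ex; exists x. Qed.

Lemma mono_ker0 M N (f : {linear M -> N}) :
  (forall x, f x = 0 -> x = 0) -> mono f.
Proof.
move=> f0 x y /eqP; rewrite -subr_eq0 -linearB => /eqP/f0/eqP.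
by rewrite subr_eq0 => /eqP.
Qed.

Lemma mono_eq0 M N (f : {linear M -> N}) x : mono f -> f x = 0 -> x = 0.
Proof. by move=> fi fx; apply: fi; rewrite fx linear0. Qed.

Lemma submod_closedP M (P : M -> Prop) :
    P 0 -> (forall a x y, P x -> P y -> P (a *: x + y)) ->
  GRing.submod_closed [pred x | `[< P x >]].
Proof.
move=> P0 PD; split=> [|a x y /asboolP Px /asboolP Py]; first exact/asboolP.
by apply/asboolP; apply: PD.
Qed.

Lemma ker_closed M N (f : {linear M -> N}) :
  GRing.submod_closed [pred x | `[< f x = 0 >]].
Proof.
apply: submod_closedP => [|a x y fx fy]; first by rewrite linear0.
by rewrite linearP fx fy scaler0 addr0.
Qed.

Lemma preim_closed M N (f : {linear M -> N}) (A : {pred N}) :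
  GRing.submod_closed A -> GRing.submod_closed [pred x | f x \in A].
Proof.
case=> A0 AD; split=> [|a x y]; rewrite !inE ?linear0 // => fx fy.
by rewrite linearP AD.
Qed.

Definition image_pred M N (f : M -> N) (A : {pred M}) : {pred N} :=
  [pred y | `[< exists2 x, x \in A & f x = y >]].

Lemma image_closed M N (f : {linear M -> N}) (A : {pred M}) :
  GRing.submod_closed A -> GRing.submod_closed (image_pred f A).
Proof.
case=> A0 AD; apply: submod_closedP => [|a _ _ [x xA <-] [y yA <-]].
  by exists 0; rewrite ?linear0.
by exists (a *: x + y); rewrite ?linearP ?AD.
Qed.

Lemma predT_closed M : GRing.submod_closed (predT : {pred M}).
Proof. by []. Qed.

Lemma submod_closedB M (A : {pred M}) : GRing.submod_closed A ->
  forall x y, x \in A -> y \in A -> x - y \in A.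
Proof. by case=> _ AD x y xA yA; rewrite addrC -scaleN1r AD. Qed.

Lemma submod_closedZ M (A : {pred M}) : GRing.submod_closed A ->
  forall a x, x \in A -> a *: x \in A.
Proof. by case=> A0 AD a x xA; rewrite -[_ *: _]addr0 AD. Qed.

Lemma submod_closedD M (A : {pred M}) : GRing.submod_closed A ->
  forall x y, x \in A -> y \in A -> x + y \in A.
Proof. by case=> A0 AD x y xA yA; rewrite -[x]scale1r AD. Qed.

Lemma factor_epi A B C (p : {linear A -> B}) (f : {linear A -> C}) :
    epi p -> (forall x, p x = 0 -> f x = 0) ->
  exists g : {linear B -> C}, forall x, g (p x) = f x.
Proof.
move=> p_epi pf.
have [|y z z'|a y y' z z'|g gP] := @linear_of_rel R B C
    (fun y z => exists2 x, p x = y & f x = z).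
- by move=> y; have [x px] := p_epi y; exists (f x), x.
- move=> [x px <-] [x' px' <-]; apply/eqP.
  by rewrite -subr_eq0 -linearB pf // linearB px px' subrr.
- by move=> [x <- <-] [x' <- <-]; exists (a *: x + x'); rewrite linearP.
exists g => x; have [x' e <-] := gP (p x); apply/eqP.
by rewrite -subr_eq0 -linearB pf // linearB e subrr.
Qed.

Lemma factor_mono X A B (i : {linear A -> B}) (f : {linear X -> B}) :
    mono i -> (forall x, exists a, i a = f x) ->
  exists g : {linear X -> A}, forall x, i (g x) = f x.
Proof.
move=> i_mono fi.
have [||c x x' a a'|g gP] := @linear_of_rel R X A (fun x a => i a = f x).
- exact: fi.
- by move=> x a a' <- /i_mono.
- by move=> e e'; rewrite !linearP e e'.
by exists g.
Qed.

Lemma coker_exists A B (i : {linear A -> B}) : mono i ->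
  exists (C : lmodType R) (p : {linear B -> C}), ses i p.
Proof.
move=> i_mono.
have [C [p [p_epi pE]]] := quot_exists (image_closed i (predT_closed A)).
exists C, p; split=> // y; split=> [/pE/asboolP[x _ <-]|[x <-]];
  first by exists x.
by apply/pE/asboolP; exists x.
Qed.

Lemma ker_exists B C (p : {linear B -> C}) : epi p ->
  exists (A : lmodType R) (i : {linear A -> B}), ses i p.
Proof.
move=> p_epi; have [A [i [i_mono iE]]] := sub_exists (ker_closed p).
exists A, i; split=> // y; split=> [py|ys]; first by apply/iE/asboolP.
by have /asboolP := (iE y).2 ys.
Qed.

Lemma image_exists M N (f : {linear M -> N}) :
  exists (I : lmodType R) (p : {linear M -> I}) (j : {linear I -> N}),
    [/\ epi p, mono j & forall x, j (p x) = f x].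
Proof.
have [I [j [j_mono jE]]] := sub_exists (image_closed f (predT_closed M)).
have [x|p pP] := factor_mono (f := f) j_mono.
  by apply/jE/asboolP; exists x.
exists I, p, j; split=> // y.
have /asboolP[x _ fx] : j y \in image_pred f predT by apply/jE; exists y.
by exists x; apply: j_mono; rewrite pP.
Qed.

Lemma pair_linear X M N (f : {linear X -> M}) (g : {linear X -> N}) :
  exists h : {linear X -> (M * N)%type}, forall x, h x = (f x, g x).
Proof.
have [a x y|h hE] := @linear_of_fun R X (M * N)%type (fun x => (f x, g x)).
  by rewrite !linearP.
by exists h.
Qed.

Lemma sum_linear X M N (f : {linear M -> X}) (g : {linear N -> X}) :
  exists h : {linear (M * N)%type -> X}, forall x y, h (x, y) = f x + g y.
Proof.
have [a x y|h hE] := @linear_of_fun R (M * N)%type X (fun x => f x.1 + g x.2).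
  by rewrite !linearP /= scalerDr addrACA.
by exists h => x y; rewrite hE.
Qed.

Lemma diff_linear X M (f g : {linear X -> M}) :
  exists h : {linear X -> M}, forall x, h x = f x - g x.
Proof.
have [a x y|h hE] := @linear_of_fun R X M (fun x => f x - g x);
  last by exists h.
by rewrite !linearP /= scalerDr addrACA.
Qed.

Lemma comp_linear X M N (g : {linear M -> N}) (f : {linear X -> M}) :
  exists h : {linear X -> N}, forall x, h x = g (f x).
Proof. by exists (g \o f). Qed.

Lemma fst_snd_ses M N (i : {linear M -> (M * N)%type}) :
  (forall x, i x = (x, 0)) -> ses i (snd : {linear (M * N)%type -> N}).
Proof.
move=> iE; split=> [x y|y|[x y]]; first by rewrite !iE => -[].
  by exists (0, y).
by split=> [/= ->|[x']]; [exists x; rewrite iE | rewrite iE => -[_ <-]].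
Qed.

Lemma free_linear M k (e : 'I_k -> M) :
  exists h : {linear 'rV[R]_k -> M}, forall r, h r = \sum_i r 0 i *: e i.
Proof.
have [a x y|h hE] :=
  @linear_of_fun R 'rV[R]_k M (fun r => \sum_i r 0 i *: e i); last by exists h.
rewrite scaler_sumr -big_split; apply: eq_bigr => i _.
by rewrite !mxE scalerDl scalerA.
Qed.

Lemma scale_linear M (x : M) : exists h : {linear R^o -> M}, forall a, h a =
  (a : R) *: x.
Proof.
have [a b c|h hE] := @linear_of_fun R R^o M (fun a => (a : R) *: x);
  last by exists h.
by rewrite scalerDl scalerA.
Qed.

Lemma fg_epi A B (p : {linear A -> B}) :
  epi p -> finitely_generated A -> finitely_generated B.
Proof.
move=> p_epi [m [e eP]]; exists m, (fun i => p (e i)) => y.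
have [x <-] := p_epi y; have [c ->] := eP x; exists c.
by rewrite linear_sum; apply: eq_bigr => i _; rewrite linearZ.
Qed.

Lemma fg_ext A B C (i : {linear A -> B}) (p : {linear B -> C}) :
  ses i p -> finitely_generated A -> finitely_generated C ->
    finitely_generated B.
Proof.
move=> [_ p_epi ex] [m [e eP]] [m' [e' e'P]].
have [f fP] := choice (fun j => p_epi (e' j)).
exists (m + m')%N,
  (fun j => match split j with inl k => i (e k) | inr k => f k end) => y.
have [c' py] := e'P (p y).
have [x xP] : exists x, i x = y - \sum_j c' j *: f j.
  apply/ex; rewrite linearB py linear_sum; apply/eqP; rewrite subr_eq0;
    apply/eqP.
  by apply: eq_bigr => j _; rewrite linearZ fP.
have [c xc] := eP x.
exists (fun j => match split j with inl k => c k | inr k => c' k end).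
rewrite big_split_ord /= -[LHS](subrK (\sum_j c' j *: f j)) -xP xc.
congr (_ + _); first rewrite linear_sum; apply: eq_bigr => j _.
  by case: split_ordP => k /eqP;
    rewrite ?(eq_lshift, eq_lrshift) // => /eqP <-; rewrite linearZ.
by case: split_ordP => k /eqP; rewrite ?(eq_rshift, eq_rlshift) // => /eqP <-.
Qed.

Lemma fg_free k : finitely_generated 'rV[R]_k.
Proof.
exists k, (fun i => delta_mx 0 i) => r; exists (r 0).
exact: row_sum_delta.
Qed.

Lemma fg_regular : finitely_generated R^o.
Proof.
exists 1%N, (fun=> 1) => x; exists (fun=> x).
by rewrite big_ord1 -[RHS]/(x * 1) mulr1.
Qed.

Lemma fg_cover M : finitely_generated M ->
  exists k (p : {linear 'rV[R]_k -> M}), epi p.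
Proof.
move=> [k [e eP]]; have [p pE] := free_linear e; exists k, p => x.
have [c ->] := eP x; exists (\row_i c i); rewrite pE.
by apply: eq_bigr => i _; rewrite mxE.
Qed.

Lemma fg_zero M : zero_module M -> finitely_generated M.
Proof. by move=> M0; exists 0%N, (fun=> 0) => x; exists (fun=> 0);
  rewrite [x]M0 [RHS]M0. Qed.

End ShortExact.

(** * Modules of finite length *)

Lemma ex_min_measure (T : Type) (f : T -> nat) (P : T -> Prop) :
  (exists x, P x) -> exists2 x, P x & forall y, P y -> (f x <= f y)%N.
Proof.
suff H m x : P x -> (f x <= m)%N ->
    exists2 x, P x & forall y, P y -> (f x <= f y)%N.
  by case=> x Px; apply: (H (f x) x).
elim: m x => [|m IHm] x Px fx.
  by exists x => // y _; rewrite (leq_trans fx).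
have [[y Py fy]|noy] := pselect (exists2 y, P y & (f y <= m)%N).
  exact: IHm Py fy.
exists x => // y Py; rewrite leqNgt; apply/negP => fyx; apply: noy.
by exists y => //; rewrite -ltnS (leq_trans fyx).
Qed.

Lemma ex_max_measure (T : Type) (f : T -> nat) (P : T -> Prop) b :
    (forall x, f x <= b)%N ->
  (exists x, P x) -> exists2 x, P x & forall y, P y -> (f y <= f x)%N.
Proof.
move=> fb /(ex_min_measure (fun x => b - f x)%N)[x Px xmin];
  exists x => // y Py.
have := xmin y Py; rewrite leq_sub2lE //.
Qed.

Section FiniteLength.
Variable R : pzRingType.
Implicit Types M N A B C X Y : lmodType R.

(* A strictly monotone [nat]-valued function on submodules exists exactly when
   the lengths of chains of submodules are bounded. *)
Definition finite_length M : Prop := exists l : {pred M} -> nat,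
  forall A B : {pred M}, GRing.submod_closed A -> GRing.submod_closed B ->
    {subset A <= B} -> ~ {subset B <= A} -> (l A < l B)%N.

Lemma strict_length_le M (l : {pred M} -> nat) (A B : {pred M}) :
    (forall A B : {pred M}, GRing.submod_closed A -> GRing.submod_closed B ->
      {subset A <= B} -> ~ {subset B <= A} -> (l A < l B)%N) ->
    GRing.submod_closed A -> GRing.submod_closed B -> {subset A <= B} ->
  (l A <= l B)%N.
Proof.
move=> l_lt A_ B_ AB; have [BA|nBA] := pselect {subset B <= A}.
  suff -> : A = B by [].
  by apply/funext => x; apply/idP/idP; [apply: AB | apply: BA].
exact/ltnW/l_lt.
Qed.

Lemma finite_length_min M (P : {pred M} -> Prop) : finite_length M ->
    (exists2 A : {pred M}, GRing.submod_closed A & P A) ->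
  exists A : {pred M}, [/\ GRing.submod_closed A, P A
    & forall B : {pred M}, GRing.submod_closed B -> P B ->
        {subset B <= A} -> {subset A <= B}].
Proof.
move=> [l l_lt] [A0 A0_ PA0].
have [|A [A_ PA] Amin] :=
    @ex_min_measure {pred M} l
      (fun A : {pred M} => GRing.submod_closed A /\ P A); first by exists A0.
exists A; split=> // B B_ PB BA; apply: contrapT => nAB.
by have := l_lt B A B_ A_ BA nAB; rewrite ltnNge Amin.
Qed.

Lemma finite_length_max M (P : {pred M} -> Prop) : finite_length M ->
    (exists2 A : {pred M}, GRing.submod_closed A & P A) ->
  exists A : {pred M}, [/\ GRing.submod_closed A, P A
    & forall B : {pred M}, GRing.submod_closed B -> P B ->
        {subset A <= B} -> {subset B <= A}].
Proof.
move=> [l l_lt] [A0 A0_ PA0].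
have [|A [A_ PA] Amax] :=
  @ex_min_measure {pred M} (fun A : {pred M} => (l predT - l A)%N)
    (fun A : {pred M} => GRing.submod_closed A /\ P A); first by exists A0.
exists A; split=> // B B_ PB AB; apply: contrapT => nBA.
have lAB := l_lt A B A_ B_ AB nBA.
have lB : (l B <= l predT)%N by apply: strict_length_le.
have := Amax B (conj B_ PB); rewrite leqNgt => /negP; apply.
exact: ltn_sub2l (leq_trans lAB lB) lAB.
Qed.

Lemma finite_length_mono A B (i : {linear A -> B}) :
  mono i -> finite_length B -> finite_length A.
Proof.
move=> i_mono [l l_lt];
  exists (fun D => l (image_pred i D)) => D E D_ E_ DE nED.
apply: l_lt; try exact: image_closed.
  by move=> _ /asboolP[x xD <-]; apply/asboolP; exists x => //; apply: DE.
move=> sub; apply: nED => x xE.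
have /asboolP[y yD /i_mono <-//] : i x \in image_pred i D.
by apply: sub; apply/asboolP; exists x.
Qed.

Lemma finite_length_epi A B (p : {linear A -> B}) :
  epi p -> finite_length A -> finite_length B.
Proof.
move=> p_epi [l l_lt];
  exists (fun D => l [pred x | p x \in D]) => D E D_ E_ DE nED.
apply: l_lt; try exact: preim_closed.
  by move=> x; rewrite !inE => /DE.
move=> sub; apply: nED => y; have [x <-] := p_epi y => pxE.
by have := sub x; rewrite !inE; apply.
Qed.

(** Nested submodules of B with the same trace on A and the same image in C coincide, so along a
    strict inclusion one of the two summands grows. Asking only that ker p lie in im i allows [i] to
    be the map from the regular module onto a cyclic submodule. *)
Lemma finite_length_ext A B C (i : {linear A -> B}) (p : {linear B -> C}) :
    (forall x, p x = 0 -> exists a, i a = x) ->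
  finite_length A -> finite_length C -> finite_length B.
Proof.
move=> pi [l l_lt] [l' l'_lt].
exists (fun D => l [pred x | i x \in D] + l' (image_pred p D))%N => D E D_ E_
  DE nED.
have sub1 : {subset [pred x | i x \in D] <= [pred x | i x \in E]}.
  by move=> x; rewrite !inE => /DE.
have sub2 : {subset image_pred p D <= image_pred p E}.
  by move=> _ /asboolP[x xD <-]; apply/asboolP; exists x => //; apply: DE.
have le1 := strict_length_le l_lt (preim_closed i D_) (preim_closed i E_) sub1.
have le2 := strict_length_le l'_lt (image_closed p D_) (image_closed p E_) sub2.
have [s1|] := pselect {subset [pred x | i x \in E] <= [pred x | i x \in D]};
  last first.
  by move=> n1; rewrite -addSn leq_add //; apply: l_lt => //;
    apply: preim_closed.
have [s2|] := pselect {subset image_pred p E <= image_pred p D}; last first.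
  by move=> n2; rewrite -addnS leq_add //; apply: l'_lt => //;
    apply: image_closed.
case: nED => x xE.
have /asboolP[y yD pyx] : p x \in image_pred p D.
  by apply: s2; apply/asboolP; exists x.
have [a ia] : exists a, i a = x - y by apply: pi; rewrite linearB pyx subrr.
have aD : a \in [pred x | i x \in D].
  by apply: s1; rewrite inE ia submod_closedB // DE.
by rewrite -(subrK y x) -ia submod_closedD.
Qed.

Lemma finite_length_zero M : zero_module M -> finite_length M.
Proof.
move=> M0; exists (fun=> 0%N) => A B [A0 _] _ _ nBA.
by case: nBA => x _; rewrite (M0 x).
Qed.

Lemma fg_finite_length M :
  finite_length R^o -> finitely_generated M -> finite_length M.
Proof.
move=> R_fl [m [e eP]]; elim: m M e eP => [|m IHm] M e eP.
  apply: finite_length_zero => x; have [c ->] := eP x.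
  by rewrite big_ord0.
have [h hE] := scale_linear (e ord0).
have [Q [p [p_epi pE]]] := quot_exists (image_closed h (predT_closed _)).
apply: (@finite_length_ext R^o M Q h p) => //.
  by move=> x /pE/asboolP[a _ <-]; exists a.
apply: (IHm Q (fun j => p (e (lift ord0 j)))) => y.
have [x <-] := p_epi y; have [c ->] := eP x.
exists (fun j => c (lift ord0 j)).
rewrite big_ord_recl linearD (_ : p _ = 0) ?add0r; last first.
  by apply/pE/asboolP; exists (c ord0); rewrite ?hE.
by rewrite linear_sum; apply: eq_bigr => j _; rewrite linearZ.
Qed.

Definition span_pred M m (e : 'I_m -> M) : {pred M} :=
  [pred x | `[< exists c : 'I_m -> R, x = \sum_(i < m) c i *: e i >]].

Lemma span_closed M m (e : 'I_m -> M) : GRing.submod_closed (span_pred e).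
Proof.
apply: submod_closedP => [|a _ _ [c ->] [d ->]].
  by exists (fun=> 0); rewrite big1 // => i _; rewrite scale0r.
exists (fun i => a * c i + d i); rewrite scaler_sumr -big_split.
by apply: eq_bigr => i _; rewrite scalerDl scalerA.
Qed.

(** A maximal member among the submodules spanned by finitely many elements of D contains D, since
    otherwise one more generator would enlarge it. *)
Lemma finite_length_span M (D : {pred M}) : finite_length M ->
    GRing.submod_closed D ->
  exists m (e : 'I_m -> M), (forall i, e i \in D) /\
    forall x, x \in D -> exists c : 'I_m -> R, x = \sum_(i < m) c i *: e i.
Proof.
move=> M_fl D_.
have [|A [A_ [m [e [eD AE]]] Amax]] := @finite_length_max M (fun A : {pred M} =>
    exists m (e : 'I_m -> M), (forall i, e i \in D) /\ A = span_pred e) M_fl.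
  exists (span_pred (fun _ : 'I_0 => 0 : M)); first exact: span_closed.
  by exists 0%N, (fun _ => 0); split=> // -[].
exists m, e; split=> // x xD.
suff : x \in A by rewrite AE => /asboolP.
pose e' (i : 'I_m.+1) := if unlift ord0 i is Some j then e j else x.
have e'D i : e' i \in D by rewrite /e'; case: unliftP.
apply: (Amax (span_pred e')); first exact: span_closed.
- by exists m.+1, e'.
- move=> y; rewrite AE => /asboolP[c ->]; apply/asboolP.
  exists (fun i => if unlift ord0 i is Some j then c j else 0).
  rewrite big_ord_recl /e' unlift_none scale0r add0r.
  by apply: eq_bigr => i _; rewrite liftK.
- apply/asboolP; exists (fun i => (i == ord0)%:R).
  rewrite big_ord_recl /e' unlift_none eqxx scale1r big1 ?addr0 // => i _.
  by rewrite scale0r.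
Qed.

Lemma finite_length_fg M : finite_length M -> finitely_generated M.
Proof.
move=> M_fl; have [m [e [_ eP]]] := finite_length_span M_fl (predT_closed M).
by exists m, e => x; apply: eP.
Qed.

End FiniteLength.

(** * Artinian commutative rings *)

Definition simple_module (R : pzRingType) (S : lmodType R) : Prop :=
  (exists x : S, x <> 0) /\
  forall x y : S, x <> 0 -> exists a : R, y = a *: x.

Lemma simple_finite_length (R : pzRingType) (S : lmodType R) :
  simple_module S -> finite_length S.
Proof.
move=> [_ S_simple].
exists (fun D => if pselect (exists2 x, x \in D & x <> 0) then 1%N else 0%N).
move=> D E D_ E_ DE nED.
case: pselect => [[x xD x0]|nD].
  case: nED => y yE; have [a ->] := S_simple x y x0.
  exact: submod_closedZ.
case: pselect => // nE; case: nED => x xE.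
have [->|x0] := pselect (x = 0); first by case: D_.
by case: nE; exists x.
Qed.

Section ArtinianRing.
Variable k : comPzRingType.
Hypothesis k_artinian : artinian k.

Lemma artinian_min (P : {pred k^o} -> Prop) :
    (exists2 A : {pred k^o}, GRing.submod_closed A & P A) ->
  exists A : {pred k^o}, [/\ GRing.submod_closed A, P A
    & forall B : {pred k^o}, GRing.submod_closed B -> P B ->
        {subset B <= A} -> {subset A <= B}].
Proof.
move=> [A0 A0_ PA0]; apply: contrapT => nomin.
have /choice[F FP] : forall A : {pred k^o}, exists B : {pred k^o},
    GRing.submod_closed A -> P A ->
    [/\ GRing.submod_closed B, P B, {subset B <= A} & ~ {subset A <= B}].
  move=> A; have [[A_ PA]|nA] := pselect (GRing.submod_closed A /\ P A);
    last first.
    by exists A => A_ PA; case: nA.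
  apply: contrapT => noB; apply: nomin; exists A; split=> // B B_ PB BA.
  by apply: contrapT => nAB; apply: noB; exists B.
pose I i := iter i F A0.
have IP i : GRing.submod_closed (I i) /\ P (I i).
  by elim: i => [//|i [I_ PI]]; have [] := FP _ I_ PI.
have [i|i x|m mP] := k_artinian (I := I).
- exact: (IP i).1.
- by have [I_ PI] := IP i; have [_ _ + _] := FP _ I_ PI; apply.
have [I_ PI] := IP m; have [_ _ _] := FP _ I_ PI; apply=> x.
by rewrite -(mP m.+1).
Qed.

Lemma mul_linear (S : lmodType k) (a : k) :
  exists h : {linear S -> S}, forall x, h x = a *: x.
Proof.
have [b x y|h hE] := @linear_of_fun k S S (fun x => a *: x); last by exists h.
by rewrite scalerDr !scalerA mulrC.
Qed.

Section MinimalInfinite.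
Variable S : lmodType k.
Hypothesis S_inf : ~ finite_length S.
Hypothesis S_min : forall (T : lmodType k) (j : {linear T -> S}),
  mono j -> ~ epi j -> finite_length T.

(** If both alternatives failed, the image and the kernel of multiplication by a would be proper
    submodules, hence of finite length, and S would be an extension of one by the other. *)
Let mul_alt (a : k) : (forall x : S, a *: x = 0) \/
  (forall y : S, exists x, a *: x = y).
Proof.
have [h hE] := mul_linear S a.
have [|na] := pselect (forall x : S, a *: x = 0); first by left.
right; apply: contrapT => nepi; apply: S_inf.
have [T [p [j [p_epi j_mono jpE]]]] := image_exists h.
have T_fl : finite_length T.
  apply: S_min j_mono _ => j_epi; apply: nepi => y.
  have [t <-] := j_epi y; have [x <-] := p_epi t.
  by exists x; rewrite jpE hE.
have [K [i [i_mono _ exi]]] := ker_exists p_epi.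
apply: (finite_length_ext (i := i) (p := p)) => //; first by move=> x /exi.
apply: S_min i_mono _ => i_epi; apply: na => x.
have [z <-] := i_epi x.
by rewrite -hE -jpE (exi (i z)).2 ?linear0 //; exists z.
Qed.

(** The chain of the ideals generated by the powers of a becomes stationary, so a^m = d a^(m+1) for
    some d. As a^m acts surjectively on S, this d inverts a there. *)
Let mul_inv (a : k) : (exists x : S, a *: x <> 0) ->
  exists d, forall x : S, d *: (a *: x) = x.
Proof.
move=> [x0 ax0].
have aS : forall y : S, exists x, a *: x = y by case: (mul_alt a) => // /(_ x0).
pose I i : {pred k^o} := [pred x | `[< exists c : k, x = c * a ^+ i >]].
have [i|i x /asboolP[c ->]|m mP] := k_artinian (I := I).
- apply: submod_closedP => [|b _ _ [c ->] [d ->]]; first by exists 0;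
  rewrite mul0r.
  by exists (b * c + d); rewrite mulrDl -mulrA.
- by apply/asboolP; exists (c * a); rewrite exprS mulrA.
have : (a ^+ m : k^o) \in I m by apply/asboolP; exists 1; rewrite mul1r.
rewrite -(mP m.+1) // => /asboolP[d am].
exists d => x.
have [y <-] : exists y, a ^+ m *: y = x.
  elim: m {mP am} x => [|m IHm] x; first by exists x; rewrite expr0 scale1r.
  have [y <-] := aS x; have [z <-] := IHm y.
  by exists z; rewrite exprS scalerA.
by rewrite !scalerA -mulrA -exprS -am.
Qed.

(** Every scalar acts on S as zero or invertibly, so S is a vector space over a residue field of k.
    A maximal subspace W avoiding some b other than 0 is a hyperplane: W has finite length, being
    proper, and S / W is simple, so S would have finite length. *)
Lemma no_minimal_infinite : False.
Proof.
have [b b0] : exists b : S, b <> 0.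
  apply: contrapT => nb; apply/S_inf/finite_length_zero => x.
  by apply: contrapT => x0; apply: nb; exists x.
(* Membership of 0 is left out because Zorn's lemma also tests the empty chain, whose union is
   empty. It is recovered for the maximal W by comparison with the singleton of 0. *)
pose P (D : set S) := (forall a x y, D x -> D y -> D (a *: x + y)) /\ ~ D b.
have [F FP Ftot|W [[WD Wb] Wmax]] := @Zorn_bigcup S P.
  split=> [a x y [D FD Dx] [E FE Ey]|[D FD Db]]; last by case: (FP D FD).
  have [DE|ED] := Ftot D E FD FE.
    by exists E => //; apply: (FP E FE).1 => //; apply: DE.
  by exists D => //; apply: (FP D FD).1 => //; apply: ED.
have W0 : W 0.
  have [[x Wx]|nW] := pselect (exists x, W x).
    by have := WD (-1) x x Wx Wx; rewrite scaleN1r addNr.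
  exfalso; apply: (Wmax [set 0]%classic).
    split=> [x Wx|sub]; first by case: nW; exists x.
    by apply: nW; exists 0; apply: sub.
  split=> [a x y -> ->|/= b00]; last exact: b0.
  by rewrite /= scaler0 addr0.
have WP : GRing.submod_closed [pred x | `[< W x >]] by apply: submod_closedP.
have Wb' x : ~ W x -> exists w c, W w /\ b = w + c *: x.
  move=> nWx; apply: contrapT => nb.
  apply: (Wmax [set y | exists w c, W w /\ y = w + c *: x]%classic).
    split=> [w Ww|sub]; first by exists w, 0; rewrite scale0r addr0.
    by apply: nWx; apply: sub; exists 0, 1; rewrite scale1r add0r.
  split=> [a _ _ [w [c [Ww ->]]] [w' [c' [Ww' ->]]]|//].
  exists (a *: w + w'), (a * c + c'); split; first exact: WD.
  by rewrite scalerDr scalerDl scalerA addrACA.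
have [T [j [j_mono jE]]] := sub_exists WP.
have [Q [p [p_epi pE]]] := quot_exists WP.
apply: S_inf; apply: (@finite_length_ext k T S Q j p).
- by move=> x /pE/jE.
- apply: S_min j_mono _ => j_epi; apply: Wb.
  by have /jE/asboolP := j_epi b.
apply: simple_finite_length; split.
  by exists (p b) => /pE/asboolP.
move=> q r; have [x <-] := p_epi q; have [y <-] := p_epi r => px0.
have Wp z : W z -> p z = 0 by move=> Wz; apply/pE/asboolP.
have nWx : ~ W x by move=> /Wp.
have [w [c [Ww bE]]] := Wb' x nWx.
suff [e eP] : exists e, p y = e *: p b.
  exists (e * c); rewrite eP bE linearD Wp // add0r linearZ /=.
  by rewrite scalerA.
have [Wy|nWy] := pselect (W y); first by exists 0; rewrite Wp // scale0r.
have [v [f [Wv bE']]] := Wb' y nWy.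
have [|d dP] := @mul_inv f.
  exists y => fy0; apply: Wb; rewrite bE' fy0 addr0.
  exact: Wv.
exists d; rewrite -[y in LHS]dP -[f *: y](addKr v) -bE'.
by rewrite !linearZ /= linearD linearN (Wp v Wv) oppr0 add0r.
Qed.

End MinimalInfinite.

(** Otherwise some ideal is minimal among those of infinite length, and all its proper submodules
    have finite length, which [no_minimal_infinite] excludes. The length of an ideal is spoken of
    through the modules embedded with that image. *)
Lemma artinian_finite_length : finite_length k^o.
Proof.
apply: contrapT => k_inf.
pose P (B : {pred k^o}) := forall (T : lmodType k) (j : {linear T -> k^o}),
  mono j -> (forall x, x \in B <-> exists t, j t = x) -> ~ finite_length T.
have [|B [B_ PB Bmin]] := @artinian_min P.
  exists (predT : {pred k^o}) => // T j j_mono jE T_fl; apply: k_inf.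
  by apply: finite_length_epi T_fl => x; apply/jE.
have [S [i [i_mono iE]]] := sub_exists B_.
apply: (@no_minimal_infinite S); first exact: PB i_mono iE.
move=> T j j_mono nj_epi; apply: contrapT => T_inf; apply: nj_epi.
have [ij ijE] := comp_linear i j.
pose C := image_pred ij predT.
have C_ : GRing.submod_closed C by apply/image_closed/predT_closed.
have sub : {subset B <= C}.
  apply: Bmin => //.
    move=> T' j' j'_mono j'E T'_fl; apply: T_inf.
    have [t|h hE] := @factor_mono _ _ _ _ j' ij j'_mono.
      by apply/j'E/asboolP; exists t.
    apply: (finite_length_mono (i := h)) T'_fl => t t' e.
    by apply/j_mono/i_mono; rewrite -!ijE -!hE e.
  by move=> _ /asboolP[t _ <-]; apply/iE; exists (j t); rewrite ijE.
move=> s; have /sub/asboolP[t _] : i s \in B by apply/iE; exists s.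
by rewrite ijE => /i_mono ts; exists t.
Qed.

End ArtinianRing.

(** Left ideals are k-submodules, as k acts through the elements [a%:A], so a strict length over k
    serves over L. *)
Lemma artin_algebra_finite_length (k : comPzRingType) (L : algType k) :
  artin_algebra L -> finite_length L^o.
Proof.
move=> [/artinian_finite_length k_fl /(fg_finite_length k_fl)[l l_lt]].
exists l => A B A_ B_ AB nBA.
have closed (D : {pred L}) : @GRing.submod_closed L L^o D ->
  @GRing.submod_closed k L D.
  move=> D_; split=> [|a x y xD yD]; first by case: D_.
  have -> : a *: x + y = (a%:A : L) * x + y by rewrite mulr_algl.
  by case: D_ => _ /(_ a%:A x y); apply.
by apply: l_lt => //; apply: closed.
Qed.

(** * Coresolutions *)

Section Splitting.
Variable R : pzRingType.
Implicit Types M N A B C X Y : lmodType R.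

Definition retract A B : Prop :=
  exists (i : {linear A -> B}) (r : {linear B -> A}), forall x, r (i x) = x.

Lemma section_of_retraction A B C (i : {linear A -> B}) (p : {linear B -> C})
    (r : {linear B -> A}) :
  ses i p -> (forall x, r (i x) = x) ->
  exists s : {linear C -> B}, forall z, p (s z) = z.
Proof.
move=> ip rK; have [_ p_epi ex] := ip.
have [d dE] := diff_linear idfun (i \o r : {linear B -> B}).
have [|s sE] := factor_epi (f := d) p_epi.
  by move=> x /ex[a <-]; rewrite dE /= rK subrr.
exists s => z; have [x <-] := p_epi z.
by rewrite sE dE linearB /= (ses_comp0 ip) subr0.
Qed.

Lemma retraction_of_section A B C (i : {linear A -> B}) (p : {linear B -> C})
    (s : {linear C -> B}) :
  ses i p -> (forall z, p (s z) = z) ->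
  exists r : {linear B -> A}, forall x, r (i x) = x.
Proof.
move=> ip sK; have [i_mono _ ex] := ip.
have [d dE] := diff_linear idfun (s \o p : {linear B -> B}).
have [|r rE] := factor_mono (f := d) i_mono.
  by move=> x; apply/ex; rewrite dE linearB /= sK subrr.
exists r => x; apply: i_mono.
by rewrite rE dE /= (ses_comp0 ip) linear0 subr0.
Qed.

Lemma retract_fg A B : retract A B -> finitely_generated B ->
  finitely_generated A.
Proof. by move=> [i [r rK]]; apply: fg_epi => x; exists (i x); apply: rK. Qed.

Lemma retract_projective A B : retract A B -> fg_projective B ->
  fg_projective A.
Proof.
move=> AB; have B_fg := retract_fg AB;
  move: AB => [i [r rK]] [/B_fg A_fg B_proj].
split=> // X Y g f X_fg Y_fg g_epi.
have [h hE] := B_proj X Y g (f \o r : {linear B -> Y}) X_fg Y_fg g_epi.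
by exists (h \o i) => x; rewrite /= hE /= rK.
Qed.

Lemma retract_injective A B : retract A B -> fg_injective B -> fg_injective A.
Proof.
move=> AB; have B_fg := retract_fg AB;
  move: AB => [i [r rK]] [/B_fg A_fg B_inj].
split=> // X Y g f X_fg Y_fg g_mono.
have [h hE] := B_inj X Y g (i \o f : {linear X -> B}) X_fg Y_fg g_mono.
by exists (r \o h) => x; rewrite /= hE /= rK.
Qed.

Lemma inj_split A B C (i : {linear A -> B}) (p : {linear B -> C}) :
    ses i p -> fg_injective A -> finitely_generated B ->
  exists r : {linear B -> A}, forall x, r (i x) = x.
Proof. by move=> [i_mono _ _] [A_fg A_inj] B_fg; apply: (A_inj _ _ i idfun).
  Qed.

Lemma proj_split A B C (i : {linear A -> B}) (p : {linear B -> C}) :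
    ses i p -> fg_projective C -> finitely_generated B ->
  exists s : {linear C -> B}, forall x, p (s x) = x.
Proof.
by move=> [_ p_epi _] [C_fg C_proj] B_fg; apply: (C_proj _ _ p idfun).
Qed.

Lemma inr_fst_ses M N (i : {linear N -> (M * N)%type}) :
  (forall x, i x = (0, x)) -> ses i (fst : {linear (M * N)%type -> M}).
Proof.
move=> iE; split=> [x y|y|[x y]]; first by rewrite !iE => -[].
  by exists (y, 0).
by split=> [/= ->|[x']]; [exists y; rewrite iE | rewrite iE => -[<- _]].
Qed.

Lemma inl_exists M N : exists i : {linear M -> (M * N)%type}, forall x, i x =
  (x, 0).
Proof. by have [i iE] :=
  pair_linear (idfun : {linear M -> M}) (\0 : {linear M -> N}); exists i. Qed.

Lemma inr_exists M N : exists i : {linear N -> (M * N)%type}, forall x, i x =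
  (0, x).
Proof. by have [i iE] :=
  pair_linear (\0 : {linear N -> M}) (idfun : {linear N -> N}); exists i. Qed.

Lemma fg_prod M N :
  finitely_generated M -> finitely_generated N ->
    finitely_generated (M * N)%type.
Proof. by have [i /fst_snd_ses] := inl_exists M N; apply: fg_ext. Qed.

Lemma injective_prod M N :
  fg_injective M -> fg_injective N -> fg_injective (M * N)%type.
Proof.
move=> [M_fg M_inj] [N_fg N_inj]; split; first exact: fg_prod.
move=> X Y g f X_fg Y_fg g_mono.
have [h hE] := M_inj X Y g (fst \o f : {linear X -> M}) X_fg Y_fg g_mono.
have [h' h'E] := N_inj X Y g (snd \o f : {linear X -> N}) X_fg Y_fg g_mono.
have [u uE] := pair_linear h h'; exists u => x.
by rewrite uE hE h'E /=; case: (f x).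
Qed.

Lemma projective_prod M N :
  fg_projective M -> fg_projective N -> fg_projective (M * N)%type.
Proof.
move=> [M_fg M_proj] [N_fg N_proj]; split; first exact: fg_prod.
move=> X Y g f X_fg Y_fg g_epi.
have [i iE] := inl_exists M N; have [j jE] := inr_exists M N.
have [h hE] := M_proj X Y g (f \o i : {linear M -> Y}) X_fg Y_fg g_epi.
have [h' h'E] := N_proj X Y g (f \o j : {linear N -> Y}) X_fg Y_fg g_epi.
have [u uE] := sum_linear h h'; exists u => -[x y].
rewrite uE linearD hE h'E /= -linearD iE jE; congr (f (_, _)).
  exact: addr0.
exact: add0r.
Qed.

Lemma injective_zero M : zero_module M -> fg_injective M.
Proof.
move=> M0; split; first exact: fg_zero.
by move=> X Y g f _ _ _; exists \0 => x; rewrite [LHS]M0 [RHS]M0.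
Qed.

Lemma projective_zero M : zero_module M -> fg_projective M.
Proof.
move=> M0; split; first exact: fg_zero.
by move=> X Y g f _ _ _; exists \0 => x; rewrite [x]M0 !linear0.
Qed.

Lemma projective_free k : fg_projective 'rV[R]_k.
Proof.
split; first exact: fg_free.
move=> X Y g f X_fg Y_fg g_epi.
have [e eE] := choice (fun i : 'I_k => g_epi (f (delta_mx 0 i))).
have [h hE] := free_linear e; exists h => r.
rewrite hE linear_sum [in RHS](row_sum_delta r) linear_sum.
by apply: eq_bigr => i _; rewrite !linearZ /= eE.
Qed.

Lemma regular_free : retract R^o 'rV[R]_1.
Proof.
have [i iE] := scale_linear (const_mx 1 : 'rV[R]_1).
have [r rE] := free_linear (fun _ : 'I_1 => 1 : R^o).
exists i, r => x; rewrite iE rE big_ord1 !mxE mulr1.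
exact: mulr1.
Qed.

Lemma projective_regular : fg_projective R^o.
Proof. by apply: retract_projective regular_free _; apply: projective_free. Qed.

Lemma projective_retract_free P : fg_projective P ->
  exists k, retract P 'rV[R]_k.
Proof.
move=> P_proj; have [k [p p_epi]] := fg_cover P_proj.1.
have [s sK] := P_proj.2 _ _ p idfun (fg_free R k) P_proj.1 p_epi.
by exists k, s, p.
Qed.

Definition projinj M : Prop := fg_projective M /\ fg_injective M.

Lemma projinj_prod M N : projinj M -> projinj N -> projinj (M * N)%type.
Proof.
by move=> [Mp Mi] [Np Ni]; split;
  [apply: projective_prod | apply: injective_prod].
Qed.

Lemma projinj_zero M : zero_module M -> projinj M.
Proof. by move=> M0; split; [apply: projective_zero | apply: injective_zero].
  Qed.

End Splitting.

(** * Coresolutions with prescribed terms and prescribed last cokernel *)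

Section Coresolutions.
Variable R : pzRingType.
Implicit Types M N A B C X Y I J : lmodType R.
Variables Inj Base : lmodType R -> Prop.

(** One recursion serves three notions, later abbreviated D, W and V: terms projective-injective and
    last cokernel finitely generated (dominant dimension at least j), terms and last cokernel
    injective (injective dimension at most j), terms projective-injective and last cokernel
    injective (both by a single coresolution). *)
Fixpoint cores (j : nat) M : Prop :=
  if j is j'.+1 then
    exists (I C : lmodType R) (i : {linear M -> I}) (p : {linear I -> C}),
      [/\ Inj I, ses i p & cores j' C]
  else Base M.

Record cores_admissible : Prop := CoresAdmissible {
  Inj_injective : forall I, Inj I -> fg_injective I;
  Inj_zero : forall I, zero_module I -> Inj I;
  Inj_prod : forall I J, Inj I -> Inj J -> Inj (I * J)%type;
  Inj_Base : forall I, Inj I -> Base I;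
  Base_retract : forall A B, retract A B -> Base B -> Base A;
  Base_ext : forall A B C (i : {linear A -> B}) (p : {linear B -> C}),
    finitely_generated B -> ses i p -> Base A -> Base C -> Base B }.

Hypothesis adm : cores_admissible.
Hypothesis R_fl : finite_length R^o.

Lemma fg_mono A B (i : {linear A -> B}) :
  mono i -> finitely_generated B -> finitely_generated A.
Proof.
move=> i_mono B_fg; apply: finite_length_fg.
exact: finite_length_mono i_mono (fg_finite_length R_fl B_fg).
Qed.

Lemma fg_ses_l A B C (i : {linear A -> B}) (p : {linear B -> C}) :
  ses i p -> finitely_generated B -> finitely_generated A.
Proof. by case=> i_mono _ _; apply: fg_mono i_mono. Qed.

Lemma fg_ses_r A B C (i : {linear A -> B}) (p : {linear B -> C}) :
  ses i p -> finitely_generated B -> finitely_generated C.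
Proof. by case=> _ p_epi _; apply: fg_epi p_epi. Qed.

(** The horseshoe lemma: an extension to B of the embedding of A, paired with the embedding of C,
    embeds B in I x J, and the cokernels form a short exact sequence again. *)
Lemma cores_ext j A B C (a : {linear A -> B}) (b : {linear B -> C}) :
  finitely_generated B -> ses a b -> cores j A -> cores j C -> cores j B.
Proof.
elim: j A B C a b => [|j IHj] A B C a b B_fg ab; first by move=> ? ?;
  apply: (Base_ext adm B_fg ab).
move=> /= [I [A' [i [p [I_inj ip A'_cores]]]]]
  [J [C' [j' [q [J_inj jq C'_cores]]]]].
have [a_mono b_epi ex_ab] := ab; have [i_mono p_epi ex_ip] := ip.
have [j_mono q_epi ex_jq] := jq.
have [I_fg I_ext] := Inj_injective adm I_inj.
have [e eE] := I_ext _ _ a i (fg_ses_l ab B_fg) B_fg a_mono.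
have [h hE] := pair_linear e (j' \o b : {linear B -> J}).
have h_mono : mono h.
  apply: mono_ker0 => x; rewrite hE => -[ex /(mono_eq0 j_mono)/ex_ab[y xE]].
  by move: ex; rewrite -xE eE => /(mono_eq0 i_mono) ->; rewrite linear0.
have [B' [pi hpi]] := coker_exists h_mono; have [_ pi_epi ex_pi] := hpi.
have [l lE] := inl_exists I J.
have [|f fE] := factor_epi (f := pi \o l : {linear I -> B'}) p_epi.
  move=> x /ex_ip[y <-]; apply/ex_pi; exists (a y).
  by rewrite hE lE eE /= (ses_comp0 ab) linear0.
have [|g gE] := factor_epi (f := q \o snd : {linear (I * J)%type -> C'}) pi_epi.
  by move=> x /ex_pi[y <-]; rewrite hE /= (ses_comp0 jq).
exists (I * J)%type, B', h, pi; split=> //;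
  first exact: Inj_prod adm _ _ I_inj J_inj.
apply: (IHj A' B' C' f g) => //.
  apply: (fg_epi pi_epi); apply: fg_prod => //.
  by have [] := Inj_injective adm J_inj.
split=> [|z|].
- apply: mono_ker0 => x'; have [x <-] := p_epi x'.
  rewrite fE => /ex_pi[z];
    rewrite hE lE => -[ez /(mono_eq0 j_mono)/ex_ab[y zE]].
  by rewrite -ez -zE eE (ses_comp0 ip).
- have [y <-] := q_epi z; exists (pi (0, y)); rewrite gE //.
- move=> w; have [[x y] <-] := pi_epi w; rewrite gE /=;
  split=> [/ex_jq[c yE]|[x' xE]].
    have [z cE] := b_epi c; exists (p (x - e z)); rewrite fE /= lE.
    apply/eqP; rewrite -subr_eq0 -linearB; apply/eqP/ex_pi; exists (- z).
    rewrite linearN hE /= cE yE; congr (_, _); last by rewrite sub0r.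
    by rewrite addrAC subrr sub0r.
  have [x'' xE'] := p_epi x'; move: xE; rewrite -xE' fE => /esym/eqP.
  rewrite -subr_eq0 -linearB => /eqP/ex_pi[z]; rewrite hE lE => -[_].
  by rewrite /= subr0 => <-; rewrite (ses_comp0 jq).
Qed.

(** Embed A in the injective I that receives B: then I / A has the submodule B / A, which is C, and
    the quotient I / B. *)
Lemma cores_ker j A B C (a : {linear A -> B}) (b : {linear B -> C}) :
  finitely_generated B -> ses a b -> cores j.+1 B -> cores j C -> cores j.+1 A.
Proof.
move=> B_fg ab [I [B' [i [p [I_inj ip B'_cores]]]]] C_cores.
have [a_mono b_epi ex_ab] := ab; have [i_mono p_epi ex_ip] := ip.
have [I_fg _] := Inj_injective adm I_inj.
have ia_mono : mono (i \o a : {linear A -> I}) by move=> x y /i_mono/a_mono.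
have [A' [pi hpi]] := coker_exists ia_mono; have [_ pi_epi ex_pi] := hpi.
exists I, A', (i \o a), pi; split=> //.
have [|f fE] := factor_epi (f := pi \o i : {linear B -> A'}) b_epi.
  by move=> x /ex_ab[y <-]; apply/ex_pi; exists y.
have [|g gE] := factor_epi (f := p) pi_epi.
  by move=> x /ex_pi[y <-] /=; rewrite (ses_comp0 ip).
apply: (cores_ext (a := f) (b := g)) C_cores B'_cores;
  first exact: fg_epi pi_epi I_fg.
split=> [|z|w].
- apply: mono_ker0 => x'; have [x <-] := b_epi x'.
  by rewrite fE => /ex_pi[y /= /i_mono <-]; rewrite (ses_comp0 ab).
- by have [y <-] := p_epi z; exists (pi y); rewrite gE.
- have [x <-] := pi_epi w; rewrite gE; split=> [/ex_ip[y <-]|[c]].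
    by exists (b y); rewrite fE.
  have [y <-] := b_epi c; rewrite fE /= => /esym/eqP.
  rewrite -subr_eq0 -linearB => /eqP/ex_pi[z /= /esym/eqP].
  by rewrite subr_eq => /eqP ->; rewrite linearD !(ses_comp0 ip) addr0.
Qed.

Lemma cores_Inj j I : Inj I -> cores j I.
Proof.
elim: j I => [|j IHj] I I_inj; first exact: Inj_Base.
have [C [p ip]] := coker_exists (i := idfun : {linear I -> I}) (fun _ _ => id).
exists I, C, idfun, p; split=> //; apply/IHj/(Inj_zero adm) => z.
by have [_ p_epi ex] := ip; have [x <-] := p_epi z; apply/ex; exists x.
Qed.

(** With e extending the embedding of A in I to B, the map (e, b) embeds B in I x C with cokernel
    A'. So I x C inherits the index j from B and A'. It passes to C as a retract when j is 0, and
    otherwise as the kernel of the projection onto I. *)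
Lemma cores_coker j A B C (a : {linear A -> B}) (b : {linear B -> C}) :
  finitely_generated B -> ses a b -> cores j.+1 A -> cores j B -> cores j C.
Proof.
move=> B_fg ab [I [A' [i [p [I_inj ip A'_cores]]]]] B_cores.
have [a_mono b_epi ex_ab] := ab; have [i_mono p_epi ex_ip] := ip.
have [I_fg I_ext] := Inj_injective adm I_inj.
have [e eE] := I_ext _ _ a i (fg_ses_l ab B_fg) B_fg a_mono.
have [h hE] := pair_linear e b.
have [|e' e'E] := factor_epi (f := p \o e : {linear B -> A'}) b_epi.
  by move=> x /ex_ab[y <-] /=; rewrite eE (ses_comp0 ip).
have [k kE] := diff_linear (p \o fst : {linear (I * C)%type -> A'}) (e' \o snd).
have IC_fg : finitely_generated (I * C)%type.
  by apply: fg_prod => //; apply: fg_epi b_epi B_fg.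
have hk : ses h k.
  split=> [|z|[x c]].
  - apply: mono_ker0 => x; rewrite hE => -[ex /ex_ab[y xE]].
    by move: ex; rewrite -xE eE => /(mono_eq0 i_mono) ->; rewrite linear0.
  - have [x <-] := p_epi z; exists (x, 0).
    by rewrite kE /= linear0 subr0.
  have [z <-] := b_epi c; rewrite kE /= e'E /= -linearB.
  split=> [/ex_ip[y yE]|[z']].
    exists (z + a y); rewrite hE !linearD eE (ses_comp0 ab) addr0 yE.
    by rewrite addrC subrK.
  rewrite hE => -[<- /eqP]; rewrite -subr_eq0 -linearB => /eqP/ex_ab[y yE].
  by rewrite -linearB -yE eE (ses_comp0 ip).
have IC := cores_ext IC_fg hk B_cores A'_cores.
have [r rE] := inr_exists I C.
case: j IC {A'_cores B_cores} => [|j] IC.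
  apply: Base_retract adm _ _ _ IC; exists r, snd => x.
  by rewrite rE.
by apply: cores_ker IC_fg (inr_fst_ses rE) IC _; apply: cores_Inj.
Qed.

(** Write B as the sum of A and a complement and embed both in the injective I of B. The cokernel of
    B in I x I has index j by [cores_coker], and I / A is a retract of it, so induction applies. *)
Lemma cores_retract j A B :
  finitely_generated B -> retract A B -> cores j B -> cores j A.
Proof.
elim: j A B => [|j IHj] A B B_fg AB; first exact: (Base_retract adm).
move: AB => [i [r rK]] B_cores.
have [I [B' [f [p [I_inj fp B'_cores]]]]] := B_cores.
have [f_mono _ _] := fp; have [I_fg _] := Inj_injective adm I_inj.
have [d dE] := diff_linear idfun (i \o r : {linear B -> B}).
have [h hE] := pair_linear (f \o (i \o r) : {linear B -> I})
  (f \o d : {linear B -> I}).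
have h_mono : mono h.
  apply: mono_ker0 => x; rewrite hE => -[/= /(mono_eq0 f_mono) irx].
  by move=> /(mono_eq0 f_mono); rewrite dE /= irx subr0.
have i_mono : mono i by move=> x y /(congr1 r); rewrite !rK.
have fi_mono : mono (f \o i : {linear A -> I}) by move=> x y /f_mono/i_mono.
have [Y [pi hpi]] := coker_exists h_mono; have [_ pi_epi ex_pi] := hpi.
have [A' [q hq]] := coker_exists fi_mono; have [_ q_epi ex_q] := hq.
exists I, A', (f \o i), q; split=> //.
have II_inj := Inj_prod adm I_inj I_inj.
have [II_fg _] := Inj_injective adm II_inj.
apply: (IHj A' Y); first exact: fg_epi pi_epi II_fg.
  have [l lE] := inl_exists I I.
  have [|u uE] := factor_epi (f := pi \o l : {linear I -> Y}) q_epi.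
    move=> x /ex_q[y <-]; apply/ex_pi; exists (i y).
    by rewrite hE lE /= dE /= rK subrr linear0.
  have [|v vE] := factor_epi (f := q \o fst : {linear (I * I)%type -> A'})
    pi_epi.
    by move=> x /ex_pi[y <-]; rewrite hE; apply/ex_q; exists (r y).
  exists u, v => x'; have [x <-] := q_epi x'.
  by rewrite uE vE /= lE.
by apply: cores_coker II_fg hpi B_cores _; apply: cores_Inj.
Qed.

End Coresolutions.

(** * Embeddings determined by simple submodules *)

Section SimpleSubmodules.
Variable R : pzRingType.
Hypothesis R_fl : finite_length R^o.
Implicit Types M N S X I : lmodType R.

Lemma simple_sub_exists M (A : {pred M}) x : finite_length M ->
    GRing.submod_closed A -> x \in A -> x <> 0 ->
  exists S (i : {linear S -> M}),
    [/\ simple_module S, mono i & forall s, i s \in A].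
Proof.
move=> M_fl A_ xA x0.
have [|D [D_ [DA [y yD y0]] Dmin]] :=
  @finite_length_min R M (fun D : {pred M} =>
    {subset D <= A} /\ exists2 y, y \in D & y <> 0) M_fl.
  by exists A => //; split=> //; exists x.
have [S [i [i_mono iE]]] := sub_exists D_.
exists S, i; split=> //; last by move=> s; apply/DA/iE; exists s.
split=> [|s t s0].
  by have [s sy] := (iE y).1 yD; exists s => s0; apply: y0;
    rewrite -sy s0 linear0.
have [h hE] := scale_linear (i s).
have iD r : i r \in D by apply/iE; exists r.
have sub : {subset D <= image_pred h predT}.
  apply: Dmin; first exact/image_closed/predT_closed.
    have hD : {subset image_pred h predT <= D}.
      by move=> _ /asboolP[a _ <-]; rewrite hE submod_closedZ.
    split=> [z /hD/DA //|]; exists (i s); last by move/(mono_eq0 i_mono).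
    by apply/asboolP; exists 1; rewrite ?hE ?scale1r.
  by move=> _ /asboolP[a _ <-]; rewrite hE submod_closedZ.
have /sub/asboolP[a _] := iD t; rewrite hE -linearZ => /i_mono <-.
by exists a.
Qed.

Lemma simple_fg S : simple_module S -> finitely_generated S.
Proof. by move=> /simple_finite_length/finite_length_fg. Qed.

Lemma zero_module_free0 : zero_module 'rV[R]_0.
Proof. by move=> x; apply: thinmx0. Qed.

(** Take a map f from X into a member of J whose kernel lies in a submodule A that is as small as
    possible. If the kernel were nonzero, A would contain a simple S; extending an embedding of S
    from S to X and pairing it with f would confine the kernel to a smaller submodule. *)
Lemma embed_of_simples (J : lmodType R -> Prop) X :
    (forall I, J I -> fg_injective I) ->
    (forall I, zero_module I -> J I) ->
    (forall I I', J I -> J I' -> J (I * I')%type) ->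
    finitely_generated X ->
    (forall S (f : {linear S -> X}), simple_module S -> mono f ->
      exists I (g : {linear S -> I}), J I /\ mono g) ->
  exists I (g : {linear X -> I}), J I /\ mono g.
Proof.
move=> J_inj J_zero J_prod X_fg X_simple.
have X_fl := fg_finite_length R_fl X_fg.
have [|A [A_ [I [f [JI fA]]] Amin]] :=
  @finite_length_min R X (fun A : {pred X} =>
    exists I (f : {linear X -> I}), J I /\ forall x, f x = 0 -> x \in A) X_fl.
  exists (predT : {pred X}) => //; exists 'rV[R]_0, \0; split=> //.
  exact/J_zero/zero_module_free0.
exists I, f; split=> //; apply: mono_ker0 => x /fA xA; apply: contrapT => x0.
have [S [i [S_simple i_mono iA]]] := simple_sub_exists X_fl A_ xA x0.
have [I' [g [JI' g_mono]]] := X_simple S i S_simple i_mono.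
have [h hE] := (J_inj _ JI').2 _ _ i g (simple_fg S_simple) X_fg i_mono.
have [u uE] := pair_linear f h.
have sub : {subset A <= [pred x | `[< u x = 0 >]]}.
  apply: Amin; first exact: ker_closed.
    exists (I * I')%type, u; split=> [|y uy]; first exact: J_prod.
    exact/asboolP.
  by move=> y /asboolP; rewrite uE => -[/fA].
have [[s s0] _] := S_simple; apply: s0.
have /sub/asboolP := iA s; rewrite uE => -[_].
by rewrite hE; apply: mono_eq0.
Qed.

Lemma simple_in_socle S N (f : {linear S -> N}) s :
  simple_module S -> mono f -> f s \in @socle R N.
Proof.
move=> S_simple f_mono; apply/asboolP; exists [:: f s]; split;
  last by rewrite big_seq1.
move=> y; rewrite inE => /eqP ->; exists (image_pred f predT); last first.
  by apply/asboolP; exists s.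
split; first exact/image_closed/predT_closed.
  have [[t t0] _] := S_simple; exists (f t); first by apply/asboolP; exists t.
  by apply/eqP => /(mono_eq0 f_mono).
move=> B B_ BS; have [B0|nB0] := pselect (forall x, x \in B -> x = 0);
  first by left.
right=> _ /asboolP[t _ <-]; apply: contrapT => ntB; apply: nB0 => x xB.
apply: contrapT => x0; have /asboolP[r _ rx] := BS x xB.
have r0 : r <> 0 by move=> r0; apply: x0; rewrite -rx r0 linear0.
have [a ta] := S_simple.2 r t r0; apply: ntB.
by rewrite ta linearZ /= rx submod_closedZ.
Qed.

End SimpleSubmodules.

(** * Dominant dimension, injective dimension and cogeneration *)

Section Classes.
Variable R : pzRingType.
Hypothesis R_fl : finite_length R^o.
Implicit Types M N A B C G I P : lmodType R.

Lemma injective_ext A B C (i : {linear A -> B}) (p : {linear B -> C}) :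
    finitely_generated B -> ses i p -> fg_injective A -> fg_injective C ->
  fg_injective B.
Proof.
move=> B_fg ip A_inj C_inj; have [r rK] := inj_split ip A_inj B_fg.
have [s sK] := section_of_retraction ip rK.
apply: retract_injective (injective_prod A_inj C_inj).
have [f fE] := pair_linear r p.
have [d dE] := diff_linear s (i \o (r \o s) : {linear C -> B}).
have [g gE] := sum_linear i d.
exists f, g => x; rewrite fE gE dE /=.
have [y yE] : exists y, i y = x - s (p x).
  by case: ip => _ _ ex; apply/ex; rewrite linearB sK subrr.
have rx : r x = y + r (s (p x)).
  by rewrite -{1}[x](subrK (s (p x))) -yE linearD rK.
by rewrite rx linearD yE addrACA subrK subrr addr0.
Qed.

Lemma projinj_fg_admissible : cores_admissible (@projinj R)
  (@finitely_generated R).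
Proof.
split=> //.
- by move=> I [].
- exact: projinj_zero.
- exact: projinj_prod.
- by move=> I [[]].
- exact: retract_fg.
Qed.

Lemma inj_inj_admissible : cores_admissible (@fg_injective R) (@fg_injective R).
Proof.
split=> //.
- exact: injective_zero.
- exact: injective_prod.
- exact: retract_injective.
- exact: injective_ext.
Qed.

Lemma projinj_inj_admissible : cores_admissible (@projinj R) (@fg_injective R).
Proof.
split=> //.
- by move=> I [].
- exact: projinj_zero.
- exact: projinj_prod.
- by move=> I [].
- exact: retract_injective.
- exact: injective_ext.
Qed.

Local Notation D := (cores (@projinj R) (@finitely_generated R)).
Local Notation W := (cores (@fg_injective R) (@fg_injective R)).
Local Notation V := (cores (@projinj R) (@fg_injective R)).

Lemma D_pred j M : D j.+1 M -> D j M.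
Proof.
elim: j M => [|j IHj] M.
  move=> [I [C [i [p [I_inj [i_mono _ _] _]]]]]; apply: (fg_mono R_fl i_mono).
  by case: I_inj => -[].
move=> [I [C [i [p [I_inj ip C_D]]]]]; exists I, C, i, p; split=> //.
exact: IHj.
Qed.

Lemma D_le m j M : (j <= m)%N -> D m M -> D j M.
Proof.
move=> /subnK <-; elim: (m - j)%N => [//|i IHi]; rewrite addSn => /D_pred.
exact: IHi.
Qed.

(** The coresolutions behind the two hypotheses may differ. The injective dimension drops by one
    along each cokernel of the projective-injective one, so its last cokernel is injective. *)
Lemma D_W_V j M : finitely_generated M -> D j M -> W j M -> V j M.
Proof.
elim: j M => [//|j IHj] M M_fg [I [C [i [p [I_pi ip C_D]]]]] M_W.
have I_fg : finitely_generated I by case: I_pi => -[].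
exists I, C, i, p; split=> //; apply: IHj => //; first exact: fg_ses_r ip I_fg.
apply: (cores_coker inj_inj_admissible R_fl I_fg ip M_W).
by apply: cores_Inj inj_inj_admissible _ _ _; case: I_pi.
Qed.

Lemma coresolution_shift M (I : nat -> lmodType R) (eta : {linear M -> I 0%N})
    (d : forall i, {linear I i -> I i.+1}) :
    injective_coresolution eta d ->
  exists C (p : {linear I 0%N -> C}) (eta' : {linear C -> I 1%N}),
    ses eta p /\
    injective_coresolution (I := fun i => I i.+1) eta' (fun i => d i.+1).
Proof.
move=> [I_inj eta_mono ex0 ex]; have [C [p hp]] := coker_exists eta_mono.
have [_ p_epi exp] := hp.
have [|eta' eE] := factor_epi (f := d 0%N) p_epi.
  by move=> x /exp[y <-]; apply/ex0; exists y.
exists C, p, eta'; split=> //; split=> //.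
  apply: mono_ker0 => z; have [x <-] := p_epi z; rewrite eE => /ex0[y <-].
  exact: ses_comp0 hp _.
move=> y; rewrite (ex 0%N y); split=> -[x].
  by move=> <-; exists (p x); rewrite eE.
by have [x' <-] := p_epi x; rewrite eE; exists x'.
Qed.

Lemma coresolution_D m M (I : nat -> lmodType R) (eta : {linear M -> I 0%N})
    (d : forall i, {linear I i -> I i.+1}) :
    injective_coresolution eta d ->
      (forall j, (j < m)%N -> fg_projective (I j)) ->
  D m M.
Proof.
elim: m M I eta d => [|m IHm] M I eta d co I_proj.
  by case: co => I_inj eta_mono _ _; apply: (fg_mono R_fl eta_mono);
    case: (I_inj 0%N).
have [C [p [eta' [etap co']]]] := coresolution_shift co.
exists (I 0%N), C, eta, p; split=> //.
  by split; [apply: I_proj | case: co].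
by apply: IHm co' _ => j jm; apply: I_proj.
Qed.

Lemma coresolution_W m M (I : nat -> lmodType R) (eta : {linear M -> I 0%N})
    (d : forall i, {linear I i -> I i.+1}) :
    injective_coresolution eta d ->
      (forall i, (m < i)%N -> zero_module (I i)) ->
  W m M.
Proof.
elim: m M I eta d => [|m IHm] M I eta d co I_zero.
  case: co => I_inj eta_mono ex0 _.
  apply: (@retract_injective R M (I 0%N)) (I_inj 0%N).
  have [x|r rE] := factor_mono (f := idfun) eta_mono.
    by apply/ex0/I_zero.
  by exists eta, r => x; apply: eta_mono; rewrite rE.
have [C [p [eta' [etap co']]]] := coresolution_shift co.
exists (I 0%N), C, eta, p; split=> //; first by case: co.
by apply: IHm co' _ => j jm; apply: I_zero.
Qed.

Lemma free_succ_retract k : retract 'rV[R]_k.+1 (R^o * 'rV[R]_k)%type.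
Proof.
have [a x y|f fE] := @linear_of_fun R 'rV[R]_(1 + k) (R^o * 'rV[R]_k)%type
    (fun r => (lsubmx r 0 0, rsubmx r)).
  congr (_, _); last by rewrite linearP.
  by rewrite linearP !mxE.
have [a [x x'] [y y']|g gE] :=
  @linear_of_fun R (R^o * 'rV[R]_k)%type 'rV[R]_(1 + k)
    (fun u => row_mx (u.1 : R)%:M u.2).
  rewrite scale_row_mx add_row_mx /=; congr row_mx.
  by rewrite scale_scalar_mx -raddfD.
exists f, g => r; rewrite gE fE /= -mx11_scalar.
exact: (@hsubmxK R 1 1 k r).
Qed.

Lemma projective_cores Inj Base j P : cores_admissible Inj Base ->
  cores Inj Base j R^o -> fg_projective P -> cores Inj Base j P.
Proof.
move=> adm R_cores /projective_retract_free[k kP].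
apply: (cores_retract adm R_fl (fg_free R k) kP) => {P kP}.
elim: k => [|k IHk].
  by apply: (cores_Inj adm); apply: (Inj_zero adm); apply: zero_module_free0.
have [i iE] := inl_exists R^o 'rV[R]_k.
have fg : finitely_generated (R^o * 'rV[R]_k)%type.
  by apply: fg_prod; [apply: fg_regular | apply: fg_free].
apply: (cores_retract adm R_fl fg (free_succ_retract k)).
exact: cores_ext adm R_fl _ _ _ _ _ _ fg (fst_snd_ses iE) R_cores IHk.
Qed.

Section Dominant.
Variable n : nat.
Hypothesis R_D : D n.+1 R^o.

(** Each image G is the kernel of the map from the next projective onto the next image. Every such
    step to the right gains one index, up to the index n + 1 of the projectives. *)
Lemma acyclic_D (P : int -> lmodType R)
  (d : forall i, {linear P i -> P (i + 1)})
    j i (G : lmodType R) (p : {linear P i -> G}) (u : {linear G -> P (i + 1)}) :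
    totally_acyclic d -> (j <= n.+1)%N ->
    epi p -> mono u -> (forall x, d i x = u (p x)) ->
  D j G.
Proof.
move=> [P_proj ex _]; elim: j i G p u => [|j IHj] i G p u jn p_epi u_mono dE.
  by apply: fg_epi p_epi _; case: (P_proj i).
have [T [p' [u' [p'_epi u'_mono uE]]]] := image_exists (d (i + 1)).
have P_fg : finitely_generated (P (i + 1)) by case: (P_proj (i + 1)).
apply: (@cores_ker _ _ _ projinj_fg_admissible R_fl j _ _ _ u p' P_fg).
- split=> // y; split=> [py|[x <-]].
    have /ex[x <-] : d (i + 1) y = 0 by rewrite -uE py linear0.
    by exists (p x); rewrite -dE.
  apply: u'_mono; rewrite uE linear0; apply/ex.
  by have [x' <-] := p_epi x; exists x'; rewrite dE.
- apply: D_le jn _; exact: projective_cores projinj_fg_admissible R_D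
  (P_proj _).
- by apply: IHj (ltnW jn) p'_epi u'_mono _ => x; rewrite uE.
Qed.

Lemma gorenstein_projective_D G j :
  (j <= n.+1)%N -> gorenstein_projective G -> D j G.
Proof. by move=> jn [P [d [ac [i [p [u [p_epi u_mono dE]]]]]]];
  apply: acyclic_D p_epi u_mono dE. Qed.

Lemma gorenstein_projective_fg G : gorenstein_projective G ->
  finitely_generated G.
Proof. by move/(gorenstein_projective_D (leq0n _)). Qed.

Lemma Gpd_D m j M : (m + j)%N = n.+1 -> Gpd_le m M -> D j M.
Proof.
elim: m j M => [|m IHm] j M mj [G [e [d [G_gp [e_epi ex0] ex G_zero]]]].
  have [|f fE] := factor_epi (f := idfun) e_epi.
    by move=> x /ex0[y <-]; rewrite (G_zero 1%N _ y) // linear0.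
  have G0_D : D j (G 0%N) by apply: gorenstein_projective_D => //; rewrite -mj.
  apply: (cores_retract projinj_fg_admissible R_fl) G0_D.
    exact: gorenstein_projective_fg.
  by exists f, e => y; have [x <-] := e_epi y; rewrite fE.
have [K [i ie]] := ker_exists e_epi; have [i_mono _ exi] := ie.
have [|e' e'E] := factor_mono (f := d 0%N) i_mono.
  by move=> x; apply/exi/ex0; exists x.
have jn : (j <= n.+1)%N by rewrite -mj leq_addl.
apply: (cores_coker projinj_fg_admissible R_fl _ ie).
- exact: gorenstein_projective_fg.
- apply: IHm; first by rewrite addnS -addSn.
  exists (fun i => G i.+1), e', (fun i => d i.+1); split=> // [|l ml];
    last exact: G_zero.
  split=> [z|y].
    have /exi/ex0[x xE] : exists z', i z' = i z by exists z.
    by exists x; apply: i_mono; rewrite e'E.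
  rewrite -(ex 0%N y) -e'E; split=> [->|/(mono_eq0 i_mono)//].
  exact: linear0.
- exact: gorenstein_projective_D.
Qed.

Lemma cogenerated_projinj M : finitely_generated M ->
  cogenerated_by_regular M <-> exists (Q : lmodType R) (g : {linear M -> Q}),
    projinj Q /\ mono g.
Proof.
move=> M_fg; split=> [[k [f f_mono]]|[Q [g [Q_pi g_mono]]]].
  have [Q [C [i [p [Q_pi [i_mono _ _] _]]]]] : D 1 'rV[R]_k.
    apply: D_le (projective_cores projinj_fg_admissible R_D
      (projective_free R k)).
    by [].
  by exists Q, (i \o f); split=> // x y /i_mono/f_mono.
have [k [i [r rK]]] := projective_retract_free Q_pi.1.
exists k, (i \o g) => x y /= /(congr1 r); rewrite !rK.
exact: g_mono.
Qed.

Lemma Gpd_cogenerated M : finitely_generated M -> Gpd_le n M ->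
  cogenerated_by_regular M.
Proof.
move=> M_fg /Gpd_D-/(_ 1%N);
  rewrite addn1 => /(_ erefl)[Q [C [i [p [Q_pi [i_mono _ _] _]]]]].
by apply/cogenerated_projinj => //; exists Q, i.
Qed.

Lemma soc_fg N : finitely_generated N -> finitely_generated (soc N).
Proof.
by apply: (fg_mono R_fl (val_inj : mono (val : {linear soc N -> N}))).
Qed.

Lemma cogenerated_soc N : finitely_generated N ->
  cogenerated_by_regular N <-> cogenerated_by_regular (soc N).
Proof.
move=> N_fg; split=> [[k [f f_mono]]|/(cogenerated_projinj (soc_fg N_fg))[Q
  [g [Q_pi g_mono]]]].
  exists k, (f \o (val : {linear soc N -> N})) => x y /f_mono; exact: val_inj.
apply/cogenerated_projinj => //; apply: embed_of_simples => //.
- by move=> I [].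
- exact: projinj_zero.
- exact: projinj_prod.
move=> S f S_simple f_mono.
have [x|h hE] := @factor_mono R S (soc N) N val f (@val_inj _ _ _).
  by exists (Soc (simple_in_socle x S_simple f_mono)).
exists Q, (g \o h); split=> // x y /= /g_mono e; apply: f_mono.
by rewrite -!hE e.
Qed.

End Dominant.

End Classes.

(** * Simple modules and indecomposable projectives *)

Section Indecomposable.
Variable R : pzRingType.
Hypothesis R_fl : finite_length R^o.
Implicit Types M N A B C S P : lmodType R.

Lemma mono_epi_isomorphic M N (f : {linear M -> N}) :
  mono f -> epi f -> isomorphic M N.
Proof.
move=> f_mono f_epi; exists f.
have [x|g gE] := factor_epi (f := idfun) f_epi.
  exact: mono_eq0.
exists g => // y; have [x <-] := f_epi y.
by rewrite gE.
Qed.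

Lemma iter_linear M (f : {linear M -> M}) m :
  exists h : {linear M -> M}, forall x, h x = iter m f x.
Proof.
elim: m => [|m [h hE]]; first by exists idfun.
by exists (f \o h) => x; rewrite /= hE.
Qed.

(** Fitting's lemma: for large m, P is the direct sum of the kernel and the image of the m-th
    iterate, and indecomposability makes one of them zero. *)
Lemma fitting P (f : {linear P -> P}) :
    finitely_generated P -> indecomposable P ->
  (exists m, forall x, iter m f x = 0) \/ (mono f /\ epi f).
Proof.
move=> P_fg [_ P_ind]; have [l l_lt] := fg_finite_length R_fl P_fg.
pose K m : {pred P} := [pred x | `[< iter m f x = 0 >]].
pose I m : {pred P} := [pred y | `[< exists x, iter m f x = y >]].
have iter0 m : iter m f 0 = 0 by have [h hE] := iter_linear f m;
  rewrite -hE linear0.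
have K_ m : GRing.submod_closed (K m).
  have [h hE] := iter_linear f m; apply: submod_closedP => // a x y.
  by rewrite -!hE linearP => -> ->; rewrite scaler0 addr0.
have I_ m : GRing.submod_closed (I m).
  have [h hE] := iter_linear f m;
    apply: submod_closedP => [|a _ _ [x <-] [y <-]].
    by exists 0.
  by exists (a *: x + y); rewrite -!hE linearP.
have KS a b : {subset K a <= K (b + a)%N}.
  by move=> x /asboolP xK; apply/asboolP; rewrite iterD xK.
have IS a b : {subset I (a + b)%N <= I a}.
  by move=> _ /asboolP[x <-]; apply/asboolP; exists (iter b f x); rewrite iterD.
have [] := @ex_max_measure _ (fun m => l (K m)) (fun=> True) (l predT).
- by move=> m; apply: strict_length_le.
- by exists 0%N.
move=> a _ aP.
have [] := @ex_min_measure _ (fun m => l (I m)) (fun=> True);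
  first by exists 0%N.
move=> b _ bP.
have {}aP c : {subset K (c + a)%N <= K a}.
  apply: contrapT => nsub; have := l_lt _ _ (K_ a) (K_ (c + a)%N) (KS a c) nsub.
  by rewrite ltnNge aP.
have {}bP c : {subset I b <= I (b + c)%N}.
  apply: contrapT => nsub; have := l_lt _ _ (I_ (b + c)%N) (I_ b) (IS b c) nsub.
  by rewrite ltnNge bP.
(* From [a] on the kernels of the iterates are constant, from [b] on their images. *)
pose m := (a + b)%N.
have KP c x : iter (c + m) f x = 0 -> iter m f x = 0.
  move=> xc; have /asboolP : x \in K (b + a)%N.
    apply/KS/(aP (c + b)%N)/asboolP.
    by rewrite -addnA [(b + a)%N]addnC.
  by rewrite addnC.
have IP c x : exists y, iter m f x = iter (m + c) f y.
  have /bP-/(_ (a + c)%N)/asboolP[y yE] : iter m f x \in I b.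
    by apply/asboolP; exists (iter a f x); rewrite -iterD addnC.
  by exists y; rewrite -yE addnA [(b + a)%N]addnC.
have [hm hmE] := iter_linear f m.
have [x||K0|I0] := P_ind (K m) (I m) (K_ m) (I_ m).
- have [y yE] := IP m x; exists (x - iter m f y).
    by apply/asboolP; rewrite -!hmE linearB /= !hmE yE iterD subrr.
  exists (iter m f y); last by rewrite subrK.
  by apply/asboolP; exists y.
- move=> y /asboolP yK /asboolP[x xE]; move: yK; rewrite -xE -iterD.
  exact: KP.
- right; split=> [|y].
    apply: mono_ker0 => x fx; apply: K0; apply/asboolP/(KP 1%N).
    by rewrite add1n iterSr fx iter0.
  have [z zE] := IP 1%N y; exists z; apply/eqP; rewrite -subr_eq0; apply/eqP/K0.
  by apply/asboolP; rewrite -hmE linearB /= !hmE -iterSr -addn1 -zE subrr.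
- by left; exists m => x; apply: I0; apply/asboolP; exists x.
Qed.

(** As v u is invertible, P' is the direct sum of im u and ker v. The former is nonzero, so the
    latter vanishes and v is invertible. *)
Lemma isomorphic_of_automorphism P P' (u : {linear P -> P'})
  (v : {linear P' -> P}) :
    indecomposable P -> indecomposable P' ->
    mono (v \o u : {linear P -> P}) -> epi (v \o u : {linear P -> P}) ->
  isomorphic P' P.
Proof.
move=> [P_nz _] [_ P'_ind] vu_mono vu_epi.
have [x|x||K0] := P'_ind _ _ (image_closed u (predT_closed P)) (ker_closed v).
- have [y yE] := vu_epi (v x); exists (u y); first by apply/asboolP; exists y.
  exists (x - u y); last by rewrite addrC subrK.
  by apply/asboolP; rewrite linearB -yE subrr.
- move=> /asboolP[y _ <-] /asboolP vuy.
  by rewrite (mono_eq0 vu_mono vuy) linear0.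
- move=> u0; case: P_nz => x; apply: vu_mono.
  by rewrite linear0 /= (u0 (u x)) ?linear0 //; apply/asboolP; exists x.
apply: (mono_epi_isomorphic (f := v)).
  by apply: mono_ker0 => x vx; apply: K0; apply/asboolP.
by move=> y; have [x <-] := vu_epi y; exists (u x).
Qed.

Lemma simple_mono S N (f : {linear S -> N}) x :
  simple_module S -> f x <> 0 -> mono f.
Proof.
move=> [_ S_simple] fx; apply: mono_ker0 => y fy; apply: contrapT => y0.
by have [a xE] := S_simple y x y0; apply: fx; rewrite xE linearZ /= fy scaler0.
Qed.

Lemma simple_epi S N (f : {linear N -> S}) x :
  simple_module S -> f x <> 0 -> epi f.
Proof.
move=> [_ S_simple] fx y; have [a ->] := S_simple _ y fx.
by exists (a *: x); rewrite linearZ.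
Qed.

(** If ker p is not contained in ker p', the map (p, p') sends P onto S x S'. Lifting (0, p') along
    it gives an endomorphism h with p h = 0 and p' h = p'. It is not nilpotent, as p' is nonzero,
    and not surjective, as p is nonzero, against Fitting's lemma. *)
Lemma simple_top_unique P S S' (p : {linear P -> S}) (p' : {linear P -> S'}) :
    fg_projective P -> indecomposable P ->
    simple_module S -> simple_module S' -> epi p -> epi p' ->
  exists h : {linear S -> S'}, mono h.
Proof.
move=> [P_fg P_proj] P_ind S_simple S'_simple p_epi p'_epi.
have [[t t0] _] := S'_simple; have [z zE] := p'_epi t.
have [pp'|] := pselect (forall x, p x = 0 -> p' x = 0).
  have [h hE] := factor_epi p_epi pp'; exists h.
  by apply: (simple_mono (x := p z)) => //; rewrite hE zE.
move=> /existsNP[x /not_implyP[px p'x]]; exfalso.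
have [f fE] := pair_linear p p'.
have f_epi : epi f.
  move=> [s s']; have [y py] := p_epi s.
  have [a aE] := S'_simple.2 (p' x) (s' - p' y) p'x.
  exists (y + a *: x); rewrite fE !linearD !linearZ /= px scaler0 addr0 py -aE.
  by rewrite addrC subrK.
have [g gE] := pair_linear (\0 : {linear P -> S}) p'.
have SS'_fg : finitely_generated (S * S')%type by apply: fg_prod;
  apply: simple_fg.
have [h hE] := P_proj _ _ f g P_fg SS'_fg f_epi.
have [ph p'h] : (forall x, p (h x) = 0) /\ (forall x, p' (h x) = p' x).
  by split=> y; have := hE y; rewrite fE gE => -[].
have [[m m0]|[_ h_epi]] := fitting h P_fg P_ind.
  have pm y : p' (iter m h y) = p' y by elim: m {m0} => //= m <-.
  by apply: t0; rewrite -zE -pm m0 linear0.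
have [[s s0] _] := S_simple; apply: s0.
by have [y <-] := p_epi s; have [w <-] := h_epi y.
Qed.

End Indecomposable.

(** * Ends of projective-injective coresolutions and the counting argument *)

Section Chains.
Variable R : pzRingType.
Hypothesis R_fl : finite_length R^o.
Implicit Types M N A B C S P Q I J : lmodType R.

Local Notation V := (cores (@projinj R) (@fg_injective R)).

(** Unlike [cores], this names the last cokernel J, so that the ends belonging to different
    projectives can be compared. *)
Fixpoint chain (j : nat) M J : Prop :=
  if j is j'.+1 then
    exists (I C : lmodType R) (i : {linear M -> I}) (p : {linear I -> C}),
      [/\ projinj I, ses i p & chain j' C J]
  else M = J.

Lemma V_chain j M : V j M -> exists J, fg_injective J /\ chain j M J.
Proof.
elim: j M => [|j IHj] M; first by exists M.
move=> [I [C [i [p [I_pi ip /IHj[J [J_inj CJ]]]]]]].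
by exists J; split=> //; exists I, C, i, p.
Qed.

(** When J is projective, the coresolution splits from its right end. *)
Lemma chain_projinj j M J : finitely_generated M ->
  chain j M J -> projinj J -> projinj M.
Proof.
elim: j M => [|j IHj] M M_fg; first by move=> /= ->.
move=> [I [C [i [p [[I_proj I_inj] ip CJ]]]]] J_pi.
have C_pi := IHj C (fg_ses_r ip I_proj.1) CJ J_pi.
have [s sK] := proj_split ip C_pi.1 I_proj.1.
have [r rK] := retraction_of_section ip sK.
have MI : retract M I by exists i, r.
by split; [apply: retract_projective MI _ | apply: retract_injective MI _].
Qed.

(** Being zero in the stable category modulo projective-injectives. A bare function [f] admits the
    iterates of an endomorphism directly. *)
Definition factors_projinj M N (f : M -> N) : Prop :=
  exists (Q : lmodType R) (a : {linear M -> Q}) (b : {linear Q -> N}),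
    projinj Q /\ forall x, f x = b (a x).

(** If f = b a through Q, extend a to a' on I. Then g - i' b a' vanishes on A, so it is s p for some
    s, and h = p' s factors through I'. *)
Lemma factors_projinj_cosyzygy A I C A' I' C'
    (i : {linear A -> I}) (p : {linear I -> C})
    (i' : {linear A' -> I'}) (p' : {linear I' -> C'})
    (f : A -> A') (g : {linear I -> I'}) (h : C -> C') :
    projinj I -> projinj I' -> ses i p -> ses i' p' ->
    (forall x, g (i x) = i' (f x)) -> (forall x, h (p x) = p' (g x)) ->
  factors_projinj f -> factors_projinj h.
Proof.
move=> [I_proj I_inj] I'_pi ip i'p' gi hp [Q [a [b [[_ [_ Q_inj]] fE]]]].
have [i_mono p_epi ex] := ip.
have [a' a'E] := Q_inj _ _ i a (fg_ses_l R_fl ip I_proj.1) I_proj.1 i_mono.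
have [d dE] := diff_linear g (i' \o (b \o a') : {linear I -> I'}).
have [|s sE] := factor_epi (f := d) p_epi.
  by move=> x /ex[y <-]; rewrite dE /= a'E -fE gi subrr.
exists I', s, p'; split=> // z; have [x <-] := p_epi z.
by rewrite sE dE hp linearB /= (ses_comp0 i'p') subr0.
Qed.

Lemma ses_lift A I C A' I' C' (i : {linear A -> I}) (p : {linear I -> C})
    (i' : {linear A' -> I'}) (p' : {linear I' -> C'}) (u : {linear C -> C'}) :
    fg_projective I -> finitely_generated I' -> ses i p -> ses i' p' ->
  exists (g : {linear I -> I'}) (f : {linear A -> A'}),
    (forall x, g (i x) = i' (f x)) /\ (forall x, u (p x) = p' (g x)).
Proof.
move=> [_ I_proj] I'_fg ip i'p'; have [i'_mono p'_epi ex'] := i'p'.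
have [g gE] := I_proj _ _ p' (u \o p : {linear I -> C'}) I'_fg
  (fg_ses_r i'p' I'_fg) p'_epi.
have [|f fE] := factor_mono (f := g \o i : {linear A -> I'}) i'_mono.
  by move=> x; apply/ex'; rewrite gE /= (ses_comp0 ip) linear0.
by exists g, f; split=> x; rewrite ?fE ?gE.
Qed.

(** Projectivity of the terms lets maps between the ends descend step by step to the starts. Stable
    vanishing of a power travels back by [factors_projinj_cosyzygy]. *)
Lemma chain_lift j M J M' J' (u : {linear J -> J'}) (v : {linear J' -> J}) :
    chain j M J -> chain j M' J' ->
  exists (u0 : {linear M -> M'}) (v0 : {linear M' -> M}), forall m,
    factors_projinj (iter m (v0 \o u0)) -> factors_projinj (iter m (v \o u)).
Proof.
elim: j M M' => [|j IHj] M M'; first by move=> /= -> ->; exists u, v.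
move=> [I [C [i [p [I_pi ip CJ]]]]] [I' [C' [i' [p' [I'_pi i'p' C'J']]]]].
have [u1 [v1 IH]] := IHj C C' CJ C'J'.
have [g [f [gi ug]]] := ses_lift u1 I_pi.1 I'_pi.1.1 ip i'p'.
have [g' [f' [g'i vg]]] := ses_lift v1 I'_pi.1 I_pi.1.1 i'p' ip.
exists f, f' => m m_null; apply: IH.
have [h hE] := iter_linear (g' \o g : {linear I -> I}) m.
apply: (factors_projinj_cosyzygy (g := h) I_pi I_pi ip ip) m_null => x;
  rewrite hE.
  by elim: m {h hE} => //= m ->; rewrite gi g'i.
by elim: m {h hE} => //= m ->; rewrite ug vg.
Qed.

Definition embeds_projinj M : Prop :=
  exists (Q : lmodType R) (f : {linear M -> Q}), projinj Q /\ mono f.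

(* If an endomorphism of [P] lifting one of [J] that fixes [S] were nilpotent,
   the latter would have a power factoring through a projective-injective
   module, which would then contain [S]. *)
Lemma chain_socle_unique j P J P' J' S (a : {linear S -> J})
  (b : {linear S -> J'}) :
    finitely_generated P -> indecomposable P -> indecomposable P' ->
    chain j P J -> chain j P' J' -> fg_injective J -> fg_injective J' ->
    simple_module S -> ~ embeds_projinj S -> mono a -> mono b ->
  isomorphic P' P.
Proof.
move=> P_fg P_ind P'_ind PJ P'J' [J_fg J_inj] [J'_fg J'_inj].
move=> S_simple S_tors a_mono b_mono; have S_fg := simple_fg S_simple.
have [u uE] := J'_inj _ _ a b S_fg J_fg a_mono.
have [v vE] := J_inj _ _ b a S_fg J'_fg b_mono.
have [u0 [v0 null]] := chain_lift u v PJ P'J'.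
have [[m m0]|[]] := fitting R_fl (v0 \o u0 : {linear P -> P}) P_fg P_ind;
  last first.
  exact: isomorphic_of_automorphism.
case: S_tors.
have [|Q [f [g [Q_pi fgE]]]] := null m.
  exists 'rV[R]_0, \0, \0; split; first exact/projinj_zero/zero_module_free0.
  exact: m0.
exists Q, (f \o a); split=> //; apply: mono_ker0 => s /= fas.
apply: (mono_eq0 a_mono).
have <- : iter m (v \o u) (a s) = a s.
  by elim: m {m0 fgE} => //= m ->; rewrite uE vE.
by rewrite fgE fas linear0.
Qed.

Lemma injective_socle_unique P P' S (a : {linear S -> P})
  (b : {linear S -> P'}) :
    indecomposable P -> indecomposable P' -> fg_injective P ->
      fg_injective P' ->
    simple_module S -> mono a -> mono b ->
  isomorphic P' P.
Proof.
move=> P_ind P'_ind [P_fg P_inj] [P'_fg P'_inj] S_simple a_mono b_mono.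
have S_fg := simple_fg S_simple.
have [u uE] := P'_inj _ _ a b S_fg P_fg a_mono.
have [v vE] := P_inj _ _ b a S_fg P'_fg b_mono.
have [[m m0]|[]] := fitting R_fl (v \o u : {linear P -> P}) P_fg P_ind;
  last first.
  exact: isomorphic_of_automorphism.
have am s : iter m (v \o u) (a s) = a s by elim: m {m0} => //= m ->;
  rewrite uE vE.
have [[s s0] _] := S_simple; case: s0; apply: (mono_eq0 a_mono).
by rewrite -am m0.
Qed.

Section Counting.
Variable n : nat.
Hypothesis R_basic : basic_ring R.
Hypothesis R_V : V n.+1 R^o.

(* Sending an indecomposable projective [P] to its socle, when [P] is
   injective, and otherwise to a simple submodule of the end of its
   coresolution that embeds in no projective-injective module, is injective on
   isomorphism classes; as there are as many simple modules as indecomposable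
   projectives, every simple module is reached. *)
Lemma simple_embeds_injective S : simple_module S ->
  exists (E : lmodType R) (f : {linear S -> E}), [/\ mono f, fg_injective E &
    projinj E \/ exists P, fg_projective P /\ chain n.+1 P E].
Proof.
have [m [P [u [dec P_ind P_niso]]]] := R_basic.
have P_proj i : fg_projective (P i).
  apply: retract_projective (projective_regular R).
  pose pi_rel i x (z : P i) := exists2 y : forall i, P i,
    x = \sum_(i < m) u i (y i) & y i = z.
  have [x|x z z'|a x x' z z'|r rE] := @linear_of_rel R R^o (P i) (pi_rel i).
  - by have [y [xE _]] := dec x; exists (y i), y.
  - move=> [y xE <-] [y' xE' <-]; have [w [_ wU]] := dec x.
    by rewrite -(wU y xE) -(wU y' xE').
  - move=> [y -> <-] [y' -> <-]; exists (fun i => a *: y i + y' i) => //.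
    by rewrite scaler_sumr -big_split; apply: eq_bigr => l _; rewrite linearP.
  exists (u i), r => x; have [y xE <-] := rE (u i x).
  have [w [_ wU]] := dec (u i x).
  (* The family with x in place i and 0 elsewhere. The transport is along a proof of i = i, which
     proof irrelevance turns into [erefl]. *)
  pose y' l : P l := if pselect (i = l) is left e then ecast l (P l) e x else 0.
  rewrite -(wU y xE) (wU y') /y'.
    by case: pselect => // e; rewrite (Prop_irrelevance e erefl).
  rewrite (bigD1 i) //= big1 ?addr0; last first.
    move=> l li; case: pselect => [e|_]; last exact: linear0.
    by case: (elimN eqP li).
  by case: pselect => // e; rewrite (Prop_irrelevance e erefl).
pose rel S i := fg_injective (P i) /\ (exists f : {linear S -> P i}, mono f) \/
  [/\ ~ fg_injective (P i), ~ embeds_projinj S & exists (J : lmodType R)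
    (f : {linear S -> J}),
    [/\ fg_injective J, chain n.+1 (P i) J & mono f]].
have rel_ex i : exists S, simple_module S /\ rel S i.
  have P_nz : exists x : P i, x <> 0.
    by apply: contrapT => nx; case: (P_ind i) => + _; apply=> x;
       apply: contrapT => x0; apply: nx; exists x.
  have [Pi_inj|Pi_ninj] := pselect (fg_injective (P i)).
    have [x x0] := P_nz.
    have [T [f [T_simple f_mono _]]] := simple_sub_exists
      (fg_finite_length R_fl (P_proj i).1) (predT_closed (P i)) isT x0.
    by exists T; split=> //; left; split=> //; exists f.
  have [J [J_inj PJ]] :=
    V_chain (projective_cores R_fl (projinj_inj_admissible R) R_V (P_proj i)).
  have [[T [f [T_simple f_mono T_tors]]]|nT] :=
    pselect (exists (T : lmodType R) (f : {linear T -> J}),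
      [/\ simple_module T, mono f & ~ embeds_projinj T]).
    by exists T; split=> //; right; split=> //; exists J, f.
  (* If every simple submodule of J embedded in a projective-injective, J itself would, and would be
     a direct summand of it. Then P i would be injective as well. *)
  have [||||T f T_simple f_mono|Q [g [Q_pi g_mono]]] :=
      @embed_of_simples R R_fl (@projinj R) J.
  - by move=> I [].
  - exact: projinj_zero.
  - exact: projinj_prod.
  - by case: J_inj.
  - by apply: contrapT => nT'; apply: nT; exists T, f.
  case: Pi_ninj; apply: (chain_projinj (P_proj i).1 PJ _).2; split=> //.
  have [r rK] := J_inj.2 _ _ g idfun J_inj.1 Q_pi.1.1 g_mono.
  by apply: retract_projective Q_pi.1; exists g, r.
have top T : simple_module T -> exists i (p : {linear P i -> T}), epi p.
  move=> T_simple; have [[t t0] _] := T_simple; have [h hE] := scale_linear t.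
  apply: contrapT => nepi; apply: t0; rewrite -[t]scale1r -hE.
  have [y [-> _]] := dec 1; rewrite linear_sum big1 // => i _.
  apply: contrapT => hu; apply: nepi; exists i, (h \o u i).
  exact: (simple_epi (f := h \o u i : {linear P i -> T}) T_simple hu).
(* The simple module attached to i is recorded by an index j such that P j maps onto it. This makes
   the assignment a self-map of a finite set, for which injectivity gives surjectivity. *)
have /choice[phi phiP] i : exists j, exists (T : lmodType R)
  (p : {linear P j -> T}),
    [/\ simple_module T, rel T i & epi p].
  have [T [T_simple Ti]] := rel_ex i; have [j [p p_epi]] := top T T_simple.
  by exists j, T, p.
have phi_inj : injective phi.
  move=> i i' e; apply: contrapT => /eqP ii'; apply: (P_niso _ _ ii').
  have [T [p [T_simple Ti p_epi]]] := phiP i.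
  have := phiP i'; rewrite -e => -[T' [p' [T'_simple Ti' p'_epi]]].
  have [h h_mono] :=
    simple_top_unique R_fl (P_proj _) (P_ind _) T_simple T'_simple p_epi p'_epi.
  (* In the two mixed cases, one of the simple modules lies in a projective-injective P while the
     other embeds in none, although each embeds in the other. *)
  case: Ti => [[Pi_inj [f f_mono]]|[Pi_ninj T_tors [J [f [J_inj PJ f_mono]]]]];
    case: Ti' => [[Pi'_inj [f' f'_mono]]|[Pi'_ninj T'_tors
      [J' [f' [J'_inj P'J' f'_mono]]]]].
  - have [fh fhE] := comp_linear f' h.
    apply: (injective_socle_unique (a := fh) (b := f)) => // x y.
    by rewrite !fhE => /f'_mono/h_mono.
  - have [h' h'_mono] :=
      simple_top_unique R_fl (P_proj _) (P_ind _) T'_simple T_simple p'_epi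
        p_epi.
    case: T'_tors; exists (P i), (f \o h'); split; first by split.
    by move=> x y /f_mono/h'_mono.
  - case: T_tors; exists (P i'), (f' \o h); split; first by split.
    by move=> x y /f'_mono/h_mono.
  - have [fh fhE] := comp_linear f' h.
    apply: (chain_socle_unique (a := fh) (b := f) _ _ _ P'J' PJ) => //.
      exact: (P_proj i').1.
    by move=> x y; rewrite !fhE => /f'_mono/h_mono.
move=> S_simple; have [j [p p_epi]] := top S S_simple.
have [i ij] : exists i, phi i = j.
  by exists (invF phi_inj j); rewrite f_invF.
have := phiP i; rewrite ij => -[T [q [T_simple Ti q_epi]]].
have [h h_mono] :=
  simple_top_unique R_fl (P_proj j) (P_ind j) S_simple T_simple p_epi q_epi.
case: Ti => [[Pi_inj [f f_mono]]|[_ _ [J [f [J_inj PJ f_mono]]]]].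
  exists (P i), (f \o h); split=> //; first by move=> x y /f_mono/h_mono.
  by left; split.
exists J, (f \o h); split=> //; first by move=> x y /f_mono/h_mono.
by right; exists (P i).
Qed.

End Counting.

End Chains.

(** * Gorenstein projective resolutions *)

Section LeftApproximation.
Variables (k : comPzRingType) (L : algType k).
Hypothesis L_artin : artin_algebra L.

Lemma ffun_finite_length m (V : lmodType k) :
  finite_length V -> finite_length {ffun 'I_m -> V}.
Proof.
move=> V_fl; elim: m => [|m IHm].
  by apply: finite_length_zero => f; apply/ffunP => -[].
have [a f g|p pE] := @linear_of_fun k {ffun 'I_m.+1 -> V} V (fun f => f ord0).
  by rewrite !ffunE.
have [a v w|i iE] := @linear_of_fun k {ffun 'I_m -> V} {ffun 'I_m.+1 -> V}
    (fun f => [ffun l => if unlift ord0 l is Some l' then f l' else 0]).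
  by apply/ffunP => l; rewrite !ffunE; case: unlift => [l'|];
    rewrite ?ffunE // scaler0 addr0.
apply: (finite_length_ext (i := i) (p := p)) => // f; rewrite pE => f0.
exists [ffun l => f (lift ord0 l)]; rewrite iE; apply/ffunP => l.
by rewrite ffunE; case: unliftP => [l' ->|->]; rewrite ?ffunE.
Qed.

(** Evaluation at generators of M embeds Hom(M, L) in L^m as a k-submodule, so it is spanned over k
    by finitely many g_i, the coordinates of [phi]. Since k acts centrally, a combination of the g_i
    with coefficients in k is [phi] followed by an L-linear map. *)
Lemma left_approximation (M : lmodType L) : finitely_generated M ->
  exists t (phi : {linear M -> 'rV[L]_t}), forall g : {linear M -> L^o},
    exists h : {linear 'rV[L]_t -> L^o}, forall x, h (phi x) = g x.
Proof.
move=> [m [e eP]]; have [k_artinian L_fg] := L_artin.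
have k_fl := artinian_finite_length k_artinian.
pose X := {ffun 'I_m -> L}.
have X_fl : finite_length X by apply/ffun_finite_length/fg_finite_length.
pose H := [pred f : X |
  `[< exists g : {linear M -> L^o}, forall i, f i = g (e i) >]].
have H_ : GRing.submod_closed H.
  apply: submod_closedP => [|a f f' [g gE] [g' g'E]].
    by exists \0 => i; rewrite ffunE.
  have [b x y|h hE] := @linear_of_fun L M L^o (fun x => a *: (g x : L) + g' x).
    have gP (q : {linear M -> L^o}) : q (b *: x + y) = b * (q x : L) + q y :> L.
      exact: linearP.
    by rewrite !gP scalerDr scalerAr addrACA -mulrDr.
  by exists h => i; rewrite hE !ffunE gE g'E.
have [t [f [fH fP]]] := finite_length_span X_fl H_.
have /choice[g gE] i : exists g : {linear M -> L^o}, forall l, f i l = g (e l).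
  exact/asboolP/fH.
have [a x y|phi phiE] := @linear_of_fun L M 'rV[L]_t (fun x => \row_i g i x).
  by apply/rowP => i; rewrite !mxE linearP.
exists t, phi => q.
have [|c cE] := fP [ffun l => q (e l)].
  by apply/asboolP; exists q => l; rewrite ffunE.
have [a x y|h hE] := @linear_of_fun L 'rV[L]_t L^o
  (fun r => \sum_i c i *: (r 0 i : L)).
  rewrite scaler_sumr -big_split; apply: eq_bigr => i _.
  by rewrite !mxE scalerDr scalerAr.
exists h => x; have [b ->] := eP x; rewrite !linear_sum; apply: eq_bigr => l _.
rewrite !linearZ /=; congr (_ *: _); rewrite hE.
have := congr1 (fun F : X => F l) cE; rewrite ffunE => ->.
by rewrite sum_ffunE; apply: eq_bigr => i _; rewrite ffunE gE phiE mxE.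
Qed.

End LeftApproximation.

(** * Lifting properties and totally acyclic complexes *)

Section Perpendicular.
Variable R : pzRingType.
Hypothesis R_fl : finite_length R^o.
Implicit Types M N A B C S P Q I J K F X Y Z : lmodType R.

Local Notation D := (cores (@projinj R) (@finitely_generated R)).
Local Notation W := (cores (@fg_injective R) (@fg_injective R)).
Local Notation V := (cores (@projinj R) (@fg_injective R)).

Variable n : nat.
Hypothesis R_basic : basic_ring R.
Hypothesis R_D : D n.+1 R^o.
Hypothesis R_W : W n.+1 R^o.
Hypothesis left_approx : forall M, finitely_generated M ->
  exists t (phi : {linear M -> 'rV[R]_t}), forall g : {linear M -> R^o},
    exists h : {linear 'rV[R]_t -> R^o}, forall x, h (phi x) = g x.

Let R_V : V n.+1 R^o.
Proof. by apply: (D_W_V R_fl _ R_D R_W); apply: fg_regular. Qed.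

(** By dimension shifting, Ext^1(M, Z) is Ext^(j+1)(M, P) for the projective P at which the
    recursion ends. *)
Fixpoint cosyzygy (j : nat) Z : Prop :=
  if j is j'.+1 then
    exists (Y I : lmodType R) (i : {linear Y -> I}) (p : {linear I -> Z}),
      [/\ fg_injective I, ses i p & cosyzygy j' Y]
  else fg_projective Z.

(* For [Z] embedding in an injective module, this is [Ext^1(M, Z) = 0]. *)
Definition lifts M Z : Prop :=
  forall I C (i : {linear Z -> I}) (p : {linear I -> C}),
    fg_injective I -> ses i p -> forall f : {linear M -> C},
  exists g : {linear M -> I}, forall x, p (g x) = f x.

(* [Ext^(j + 1)(M, P) = 0] for all [j >= m] and all projective [P]. *)
Definition perp_from (m : nat) M : Prop :=
  forall j Z, (m <= j)%N -> cosyzygy j Z -> lifts M Z.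

Lemma perp_from_le m m' M : (m <= m')%N -> perp_from m M -> perp_from m' M.
Proof. by move=> mm' M_perp j Z m'j; apply/M_perp/(leq_trans mm'). Qed.

Lemma cosyzygy_fg j Z : cosyzygy j Z -> finitely_generated Z.
Proof.
case: j => [[]|j [Y [I [i [p [[I_fg _] [_ p_epi _] _]]]]]] //.
exact: fg_epi p_epi I_fg.
Qed.

Lemma cosyzygy_W j Z : cosyzygy j Z -> W (n.+1 - j) Z.
Proof.
elim: j Z => [|j IHj] Z.
  exact: (projective_cores R_fl (inj_inj_admissible R) R_W).
move=> [Y [I [i [p [I_inj ip /IHj]]]]]; rewrite subnS.
(* The subtraction is truncated: once the bound is 0 it stays there, because with Y injective the
   sequence splits and Z is injective too. *)
case: (n.+1 - j)%N => [Y_inj|s Y_W] /=.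
  have [r rK] := inj_split ip Y_inj I_inj.1.
  have [s sK] := section_of_retraction ip rK.
  by apply: retract_injective I_inj; exists s, p.
apply: (cores_coker (inj_inj_admissible R) R_fl I_inj.1 ip Y_W).
exact: (cores_Inj (inj_inj_admissible R)).
Qed.

Lemma lifts_injective M Z : fg_injective Z -> lifts M Z.
Proof.
move=> Z_inj I C i p I_inj ip f.
have [r rK] := inj_split ip Z_inj I_inj.1.
have [s sK] := section_of_retraction ip rK.
by exists (s \o f) => x; rewrite /= sK.
Qed.

Lemma perp_from_injdim M : perp_from n.+1 M.
Proof.
move=> j Z nj /cosyzygy_W; have /eqP -> : (n.+1 - j == 0)%N by rewrite subn_eq0.
exact: lifts_injective.
Qed.

Lemma lifts_projective P Z : fg_projective P -> lifts P Z.
Proof.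
move=> [_ P_proj] I C i p [I_fg _] ip f; have [_ p_epi _] := ip.
by apply: P_proj => //; apply: fg_ses_r ip I_fg.
Qed.

(** Each step removed at the left turns an a-th cosyzygy into an (a+1)-th one, until only the last
    term and its map onto J remain. *)
Lemma chain_cosyzygy a j Y J : cosyzygy a Y -> chain j.+1 Y J ->
  exists (Z I : lmodType R) (i : {linear Z -> I}) (p : {linear I -> J}),
    [/\ projinj I, ses i p & cosyzygy (a + j) Z].
Proof.
elim: j a Y => [|j IHj] a Y aY [I [C [i [p [I_pi ip CJ]]]]].
  by move: p ip; rewrite CJ addn0 => p ip; exists Y, I, i, p.
rewrite addnS -addSn; apply: IHj CJ.
by exists Y, I, i, p; split=> //; case: I_pi.
Qed.

Lemma enough_injectives X : finitely_generated X ->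
  exists (E : lmodType R) (f : {linear X -> E}), fg_injective E /\ mono f.
Proof.
move=> X_fg; apply: embed_of_simples => //.
- exact: injective_zero.
- exact: injective_prod.
move=> S f S_simple _.
have [E [g [g_mono E_inj _]]] :=
  simple_embeds_injective R_fl R_basic R_V S_simple.
by exists E, g.
Qed.

(** Use as targets the injectives E for which every map from C lifts to some projective-injective Q
    over E. An end J qualifies, because the kernel of the last term onto J is an n-th cosyzygy of a
    projective. A lift of an embedding of C is again an embedding. *)
Lemma perp_cogenerated C : finitely_generated C -> perp_from 0 C ->
  cogenerated_by_regular C.
Proof.
move=> C_fg C_perp; pose J E := fg_injective E /\
  exists (Q : lmodType R) (q : {linear Q -> E}), projinj Q /\
    forall f : {linear C -> E}, exists g : {linear C -> Q}, forall x, q (g x) =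
      f x.
have [||||S f S_simple _|E [f [[E_inj [Q [q [Q_pi qP]]]] f_mono]]] :=
    @embed_of_simples R R_fl J C.
- by move=> E [].
- move=> E E0; split; first exact: injective_zero.
  by exists E, idfun; split=> [|f]; [apply: projinj_zero | exists f].
- move=> E E' [E_inj [Q [q [Q_pi qP]]]] [E'_inj [Q' [q' [Q'_pi q'P]]]].
  split; first exact: injective_prod.
  have [u uE] := pair_linear (q \o fst : {linear (Q * Q')%type -> E})
    (q' \o snd).
  exists (Q * Q')%type, u; split=> [|f]; first exact: projinj_prod.
  have [g gE] := qP (fst \o f : {linear C -> E}).
  have [g' g'E] := q'P (snd \o f : {linear C -> E'}).
  have [h hE] := pair_linear g g'; exists h => x.
  by rewrite hE uE /= gE g'E /=; case: (f x).
- exact: C_fg.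
- have [E [g [g_mono E_inj E_alt]]] :=
    simple_embeds_injective R_fl R_basic R_V S_simple.
  exists E, g; split=> //; split=> //.
  case: E_alt => [E_pi|[P [P_proj PE]]].
    by exists E, idfun; split=> // h; exists h.
  have [Z [I [i [p [I_pi ip Z_cos]]]]] := @chain_cosyzygy 0 n P E P_proj PE.
  exists I, p; split=> //; apply: C_perp Z_cos _ _ i p I_pi.2 ip.
  by [].
apply/(cogenerated_projinj R_fl R_D C_fg); have [g gE] := qP f.
by exists Q, g; split=> // x y e; apply: f_mono; rewrite -!gE e.
Qed.

(** Embed Z in an injective E with cokernel Y and extend g to a map e from F to E. It induces a map
    from M to Y, which lifts to s from M to E; then e - s p takes values in Z and still restricts to
    g. *)
Lemma lifts_extend M Z K F (i : {linear K -> F}) (p : {linear F -> M})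
    (g : {linear K -> Z}) :
    finitely_generated Z -> finitely_generated F -> ses i p -> lifts M Z ->
  exists h : {linear F -> Z}, forall x, h (i x) = g x.
Proof.
move=> Z_fg F_fg ip MZ; have [i_mono p_epi ex] := ip.
have [E [j [E_inj j_mono]]] := enough_injectives Z_fg.
have [Y [q jq]] := coker_exists j_mono; have [_ _ exq] := jq.
have [e eE] := E_inj.2 _ _ i (j \o g : {linear K -> E}) (fg_ses_l R_fl ip F_fg)
  F_fg i_mono.
have [|f fE] := factor_epi (f := q \o e : {linear F -> Y}) p_epi.
  by move=> x /ex[y <-] /=; rewrite eE (ses_comp0 jq).
have [s sE] := MZ E Y j q E_inj jq f.
have [d dE] := diff_linear e (s \o p : {linear F -> E}).
have [|h hE] := factor_mono (f := d) j_mono.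
  by move=> x; apply/exq; rewrite dE linearB /= sE fE subrr.
exists h => x; apply: j_mono.
by rewrite hE dE eE /= (ses_comp0 ip) linear0 subr0.
Qed.

(** For Z inside I with cokernel C, the next cosyzygy, a map from K to C extends to F by the
    hypothesis on M and then lifts to I by projectivity of F. *)
Lemma perp_syzygy m M K F (i : {linear K -> F}) (p : {linear F -> M}) :
  fg_projective F -> ses i p -> perp_from m.+1 M -> perp_from m K.
Proof.
move=> [F_fg F_proj] ip M_perp j Z mj Z_cos I C a b I_inj ab f.
have C_cos : cosyzygy j.+1 C by exists Z, I, a, b.
have C_fg := cosyzygy_fg C_cos.
have [h hE] := lifts_extend f C_fg F_fg ip (M_perp j.+1 C mj C_cos).
have [_ b_epi _] := ab.
have [g gE] := F_proj _ _ b h I_inj.1 C_fg b_epi.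
by exists (g \o i) => x; rewrite /= gE hE.
Qed.

Lemma extend_projective M F Z (phi : {linear M -> F}) :
    (forall g : {linear M -> R^o},
      exists h : {linear F -> R^o}, forall x, h (phi x) = g x) ->
    fg_projective Z ->
  forall g : {linear M -> Z}, exists h : {linear F -> Z}, forall x, h (phi x) =
    g x.
Proof.
move=> phiP /projective_retract_free[s [i [r rK]]] g.
have /choice[h hE] l : exists h : {linear F -> R^o}, forall x, h (phi x) = i
  (g x) 0 l.
  have [a x y|c cE] := @linear_of_fun R M R^o (fun x => i (g x) 0 l).
    by rewrite !linearP !mxE.
  by have [h hE] := phiP c; exists h => x; rewrite hE cE.
have [a x y|u uE] := @linear_of_fun R F 'rV[R]_s (fun y => \row_l h l y).
  by apply/rowP => l; rewrite !mxE linearP.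
exists (r \o u) => x; rewrite /= -[RHS]rK; congr (r _).
by rewrite uE; apply/rowP => l; rewrite mxE hE.
Qed.

(** What has to be shown is that every map from M to Z extends to F. For Z projective this is the
    approximation property; for a later cosyzygy the map lifts to the preceding injective, and the
    lift extends. *)
Lemma perp_coker M F C (phi : {linear M -> F}) (p : {linear F -> C}) :
    fg_projective F -> finitely_generated M -> ses phi p ->
    (forall g : {linear M -> R^o},
      exists h : {linear F -> R^o}, forall x, h (phi x) = g x) ->
  perp_from 0 M -> perp_from 0 C.
Proof.
move=> F_proj M_fg php phiP M_perp j Z _ Z_cos I C' a b I_inj ab f.
have [phi_mono p_epi ex] := php; have [a_mono b_epi exab] := ab.
have ext (g : {linear M -> Z}) : exists h : {linear F -> Z}, forall x, h
  (phi x) = g x.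
  case: j Z_cos => [|j] /= Z_cos; first exact: extend_projective phiP Z_cos g.
  have [Y [I' [c [d [I'_inj cd Y_cos]]]]] := Z_cos.
  have [g' g'E] := M_perp j Y isT Y_cos I' Z c d I'_inj cd g.
  have [h hE] := I'_inj.2 _ _ phi g' M_fg F_proj.1 phi_mono.
  by exists (d \o h) => x; rewrite /= hE g'E.
have C'_fg := fg_ses_r ab I_inj.1.
have [e eE] := F_proj.2 _ _ b (f \o p : {linear F -> C'}) I_inj.1 C'_fg b_epi.
have [|g gE] := factor_mono (f := e \o phi : {linear M -> I}) a_mono.
  by move=> x; apply/exab; rewrite /= eE /= (ses_comp0 php) linear0.
have [h hE] := ext g.
have [d dE] := diff_linear e (a \o h : {linear F -> I}).
have [|s sE] := factor_epi (f := d) p_epi.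
  by move=> x /ex[y <-]; rewrite dE /= hE gE subrr.
exists s => z; have [x <-] := p_epi z.
by rewrite sE dE linearB /= eE (ses_comp0 ab) subr0.
Qed.

(** Acyclic steps in both directions lead from this class back into it, so they can be spliced into
    a totally acyclic complex. *)
Definition perp_torsionless M : Prop :=
  [/\ finitely_generated M, perp_from 0 M & cogenerated_by_regular M].

Definition acyclic_step A B : Prop :=
  exists (P : lmodType R) (i : {linear A -> P}) (p : {linear P -> B}),
    [/\ fg_projective P, ses i p & forall g : {linear A -> R^o},
      exists h : {linear P -> R^o}, forall x, h (i x) = g x].

Lemma acyclic_step_right M : perp_torsionless M ->
  exists C, perp_torsionless C /\ acyclic_step M C.
Proof.
move=> [M_fg M_perp [s [f f_mono]]].
have [t [phi phiP]] := left_approx M_fg.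
have [h hE] := extend_projective phiP (projective_free R s) f.
have phi_mono : mono phi by move=> x y e; apply: f_mono; rewrite -!hE e.
have [C [p php]] := coker_exists phi_mono.
have F_proj := projective_free R t.
have C_fg := fg_ses_r php F_proj.1.
have C_perp := perp_coker F_proj M_fg php phiP M_perp.
exists C; split; first by split=> //; apply: perp_cogenerated.
by exists 'rV[R]_t, phi, p.
Qed.

Lemma acyclic_step_left M : perp_torsionless M ->
  exists K, perp_torsionless K /\ acyclic_step K M.
Proof.
move=> [M_fg M_perp _]; have [t [p p_epi]] := fg_cover M_fg.
have [K [i ip]] := ker_exists p_epi; have [i_mono _ _] := ip.
have F_proj := projective_free R t.
exists K; split.
  split; first exact: (fg_ses_l R_fl ip F_proj.1).
    exact: (perp_syzygy F_proj ip (perp_from_le _ M_perp)).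
  by exists t, i.
exists 'rV[R]_t, i, p; split=> // g.
apply: (lifts_extend g _ F_proj.1 ip); first exact: fg_regular.
by apply: (M_perp 0%N) => //; apply: projective_regular.
Qed.

Lemma perp_torsionless_gorenstein M : perp_torsionless M ->
  gorenstein_projective M.
Proof.
move=> M_pt.
(* Outside the class the value is A itself, a default that the iteration from M never meets. *)
have /choice[nxt nxtP] A : exists B, perp_torsionless A ->
    perp_torsionless B /\ acyclic_step A B.
  have [/acyclic_step_right[B]|nA] := pselect (perp_torsionless A);
    first by exists B.
  by exists A => /nA.
have /choice[prv prvP] A : exists B, perp_torsionless A ->
    perp_torsionless B /\ acyclic_step B A.
  have [/acyclic_step_left[B]|nA] := pselect (perp_torsionless A);
    first by exists B.
  by exists A => /nA.
(* [Negz a] stands for -(a + 1), hence the a + 1 steps to the left. *)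
pose T (i : int) : lmodType R :=
  match i with Posz a => iter a nxt M | Negz a => iter a.+1 prv M end.
have nxt_pt a : perp_torsionless (iter a nxt M).
  by elim: a => //= a IHa; have [] := nxtP _ IHa.
have prv_pt a : perp_torsionless (iter a prv M).
  by elim: a => //= a IHa; have [] := prvP _ IHa.
have T_step i : acyclic_step (T i) (T (i + 1)).
  case: i => a.
    by rewrite -PoszD addn1; have [] := nxtP _ (nxt_pt a).
  case: a => [|a]; first by have [] := prvP _ (prv_pt 0%N).
  have -> : Negz a.+1 + 1 = Negz a by rewrite !NegzE -[a.+2]addn1 PoszD opprD
    subrK.
  by have [] := prvP _ (prv_pt a.+1).
have /choice[P PP] := T_step.
pose iP i := cid (PP i); pose io i : {linear T i -> P i} := projT1 (iP i).
pose pP i := cid (projT2 (iP i)).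
pose pr i : {linear P i -> T (i + 1)} := projT1 (pP i).
have step i : [/\ fg_projective (P i), ses (io i) (pr i) & forall g :
  {linear T i -> R^o},
      exists h : {linear P i -> R^o}, forall x, h (io i x) = g x] :=
        projT2 (pP i).
exists P, (fun i => io (i + 1) \o pr i); split; last first.
  (* The module M is [T 0], the image of the differential that starts in degree -1. *)
  exists (Negz 0), (pr (Negz 0)), (io (Negz 0 + 1)).
  have [_ [_ pr_epi _] _] := step (Negz 0).
  by have [_ [io_mono _ _] _] := step (Negz 0 + 1).
split=> [i|i y|i g g0].
- by case: (step i).
- have [_ [_ pr_epi _] _] := step i; have [_ [_ _ ex] _] := step (i + 1).
  have [_ [io_mono _ _] _] := step (i + 1 + 1).
  split=> [/(mono_eq0 io_mono)/ex[z <-]|[x <-]] /=.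
    by have [x <-] := pr_epi z; exists x.
  by rewrite (ex (io (i + 1) (pr i x))).2 ?linear0 //; exists (pr i x).
- have [_ [_ pr_epi _] _] := step i; have [_ [_ pr_epi' ex] _] := step (i + 1).
  have [_ _ ext] := step (i + 1 + 1).
  have [|g' g'E] := factor_epi (f := g) pr_epi'.
    by move=> x /ex[z <-]; have [w <-] := pr_epi z; apply: g0.
  have [h hE] := ext g'; exists h => y.
  by rewrite /= hE g'E.
Qed.

Lemma projective_gorenstein P : fg_projective P -> gorenstein_projective P.
Proof.
move=> P_proj; apply: perp_torsionless_gorenstein; split; first by case: P_proj.
  by move=> j Z _ _; apply: lifts_projective.
have [s [i [r rK]]] := projective_retract_free P_proj.
by exists s, i => x y /(congr1 r); rewrite !rK.
Qed.

Lemma gorenstein_Gpd0 M : gorenstein_projective M -> Gpd_le 0 M.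
Proof.
move=> M_gp; pose G i : lmodType R := if i is _.+1 then 'rV[R]_0 else M.
have Z0 := @zero_module_free0 R.
exists G, (idfun : {linear M -> M}), (fun i => \0); split.
- case=> [|i] //=; exact/projective_gorenstein/projective_zero.
- split=> [x|x]; first by exists x.
  by split=> [/= ->|[z <-] //]; exists 0.
- by move=> i y; split=> _; [exists 0; rewrite (Z0 y) | ].
- by case.
Qed.

Lemma Gpd_succ m M K P (i : {linear K -> P}) (p : {linear P -> M}) :
  gorenstein_projective P -> ses i p -> Gpd_le m K -> Gpd_le m.+1 M.
Proof.
move=> P_gp [i_mono p_epi ex] [G [e [d [G_gp [e_epi ex0] exd G_zero]]]].
pose G' l : lmodType R := if l is l'.+1 then G l' else P.
pose d' l : {linear G' l.+1 -> G' l} :=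
  match l with 0%N => (i \o e : {linear G 0%N -> P}) | l'.+1 => d l' end.
exists G', p, d'; split.
- by case.
- split=> // y; split=> [/ex[z <-]|[x <-]].
    by have [x <-] := e_epi z; exists x.
  by apply/ex; exists (e x).
- case=> [|l] //= y; rewrite -(ex0 y); split=> [/(mono_eq0 i_mono)//|ey].
  by rewrite /d' /= ey linear0.
- by case=> // l ml; apply: G_zero.
Qed.

(** Each syzygy lowers the index of [perp_from] by one and is torsionless, lying in a free module.
    At index 0 it is Gorenstein projective. *)
Lemma perp_from_Gpd m M : finitely_generated M -> perp_from m M ->
  cogenerated_by_regular M -> Gpd_le m M.
Proof.
elim: m M => [|m IHm] M M_fg M_perp M_cog.
  exact/gorenstein_Gpd0/perp_torsionless_gorenstein.
have [t [p p_epi]] := fg_cover M_fg.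
have [K [i ip]] := ker_exists p_epi; have [i_mono _ _] := ip.
have F_proj := projective_free R t.
apply: (Gpd_succ (projective_gorenstein F_proj) ip); apply: IHm.
- exact: (fg_ses_l R_fl ip F_proj.1).
- exact: (perp_syzygy F_proj ip M_perp).
- by exists t, i.
Qed.

(** The index n + 1 holds for every module, in particular for the cokernel of an embedding of N in a
    free module; N is its syzygy and so has index n. *)
Lemma cogenerated_Gpd N : finitely_generated N ->
  cogenerated_by_regular N -> Gpd_le n N.
Proof.
move=> N_fg N_cog; apply: perp_from_Gpd => //.
have [t [f f_mono]] := N_cog; have [X [p fp]] := coker_exists f_mono.
exact: (perp_syzygy (projective_free R t) fp (@perp_from_injdim X)).
Qed.

End Perpendicular.

Theorem theorem3p3 (n : nat) (k : comPzRingType) (L : algType k)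
    (N : lmodType L) (hn : (0 < n)%N)
    (hL : minimal_Auslander_Gorenstein n L) (hbasic : basic_ring L)
    (hN : finitely_generated N) :
  (Gpd_le n N <-> Gpd_le n (soc N)) /\
  (Gpd_le n N <-> cogenerated_by_regular N).
Proof.
have [L_artin [I [eta [d [co I_zero]]]] [I' [eta' [d' [[co' _ _] I'_proj]]]]] := hL.
have L_fl := artin_algebra_finite_length L_artin.
have L_D := coresolution_D L_fl co' I'_proj.
have L_W := coresolution_W co I_zero.
have Gpd_cog (M : lmodType L) : finitely_generated M ->
    Gpd_le n M <-> cogenerated_by_regular M.
  move=> M_fg; split; first exact: (Gpd_cogenerated L_fl L_D M_fg).
  exact: (cogenerated_Gpd L_fl hbasic L_D L_W (left_approximation L_artin) M_fg).
split; last exact: Gpd_cog.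
rewrite Gpd_cog // Gpd_cog; last exact: soc_fg.
exact: (cogenerated_soc L_fl L_D hN).
Qed.
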